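(* Let $u_0\in L^2([0,1])$ and $$\tau_{\mathcal B}(u_0)=h_1^{-1}\Big(\frac{m_0^2}{\|H(u_0)-\tilde f_0\|_{L^2}}\Big)$$ (with $\tau_{\mathcal B}(u_0)=0$ if $H(u_0)=\tilde f_0$). Then for every $t>\tau_{\mathcal B}(u_0)$ and $x\in[0,1]$, the Burgers orbit $u(t,\cdot)=\Phi^t_{\mathcal B}(u_0)$ has the convergent Koopman decomposition (summed in the indicated order) $$u(t,x)=\sum_{q_0=0}^\infty\ \sum_{m=0}^\infty\ \sum_{(q_1,\dots,q_m)\in(\mathbb{N}\setminus\{0\})^m}e^{-\lambda_\nu t}\,\varphi_\nu(u_0)\,a_\nu(x),\qquad \nu=(q_0,q_1,\dots,q_m),$$ where $$\lambda_\nu=\sum_{i=0}^m(\mu_{q_i}-\mu_0),\qquad \varphi_\nu(u_0)=\prod_{i=0}^m\frac{c_{q_i}(H(u_0))}{c_0(H(u_0))},\qquad a_\nu(x)=2(-1)^{m+1}\frac{\partial_xe_{q_0}(x)}{e_0(x)}\prod_{i=1}^m\frac{e_{q_i}(x)}{e_0(x)}.$$ In particular, for every $\theta_0>0$ the set $$\Omega_{\mathcal B}(\theta_0)=\Big\{u_0\in L^2([0,1]):\ \|H(u_0)-\tilde f_0\|_{L^2}<\frac{m_0^2}{h_1(\theta_0)}\Big\}$$ is a neighbourhood in $L^2([0,1])$ of $s_0=-2\,\partial_xe_0/e_0$, and for every $u_0\in\Omega_{\mathcal B}(\theta_0)$ the decomposition above holds for all $t>\theta_0$.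
   Context: $V:[0,1]\to\mathbb{R}$ is a fixed smooth, strictly positive function; $\mathbb{N}=\{0,1,2,\dots\}$. The Burgers flow $\Phi^t_{\mathcal B}$ on $L^2([0,1])$ is defined by $\Phi^t_{\mathcal B}(u_0)=u(t,\cdot)$, where $u$ is the solution (continuous in $t\ge0$ with values in $L^2([0,1])$, infinitely differentiable in $x$ and satisfying the equation and boundary conditions classically for $t>0$) of $$\partial_tu+u\,\partial_xu=\partial^2_{xx}u+2\partial_xV,\qquad u(t,0)=u(t,1)=0,\qquad u(0,x)=u_0(x).$$ The operator $A=-\partial^2_{xx}+V$ on $[0,1]$ with Neumann boundary conditions is self-adjoint, with eigenvalues $0<\mu_0<\mu_1\le\mu_2\le\dots$ and a complete orthonormal family $(e_n)_{n\in\mathbb{N}}$ in $L^2([0,1])$ of real eigenfunctions: $-\partial_{xx}^2e_n+Ve_n=\mu_ne_n$, $\partial_xe_n(0)=\partial_xe_n(1)=0$; $e_0$ is chosen with $e_0>0$ on $[0,1]$, and $m_0=\inf_{[0,1]}e_0>0$. Put $c_n(v)=\int_0^1e_n(x)v(x)\,dx$ and $\tilde f_0=e_0/\int_0^1e_0(\xi)d\xi$. The Cole-Hopf transform is $$H(u)(x)=\frac{e^{-\frac12\int_0^xu(s)ds}}{\int_0^1e^{-\frac12\int_0^yu(s)ds}dy},\qquad u\in L^2([0,1]).$$ Let $C_1>0$ be a constant with $\sup_{[0,1]}|f|\le C_1\|f\|_{H^1}$ for all $f\in H^1(]0,1[)$, where $\|f\|_{H^1}^2=\|f\|_{L^2}^2+\|\partial_xf\|_{L^2}^2$.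 Set $$h_1(t)=C_1\sqrt{\sum_{n=1}^\infty(1+\mu_n)e^{-2(\mu_n-\mu_0)t}},\qquad t>0,$$ a continuous decreasing bijection from $]0,\infty[$ onto $]0,\infty[$. For $m=0$ the inner sum has a single term and empty products equal $1$. *)

(* Defs.v *)
From HB Require Import structures.
From mathcomp Require Import all_boot all_order all_algebra.
From mathcomp Require Import all_classical all_reals all_analysis.
From mathcomp Require summability.

Set Implicit Arguments.
Unset Strict Implicit.
Unset Printing Implicit Defensive.

Import Order.TTheory GRing.Theory Num.Theory.
Import numFieldNormedType.Exports.

Local Open Scope classical_set_scope.
Local Open Scope ring_scope.

(* Functions on [0, 1] are functions R -> R of which only the values on [0, 1]
   matter. *)
Section unit_interval.
Context {R : realType}.
Implicit Types f g u v : R -> R.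

(* Derivatives on the closed interval are two-sided inside ]0, 1[ and one-sided
   at the endpoints. *)
Definition diff_quot01 f (x : R) : set_system R :=
  (f y - f x) / (y - x) @[y --> within `[0, 1] x^'].

Definition derivable01 f (x : R) : Prop := cvg (diff_quot01 f x).

Definition D01 f (x : R) : R := lim (diff_quot01 f x).

Definition smooth01 f : Prop :=
  forall (k : nat) (x : R), x \in `[0, 1] -> derivable01 (iter k D01 f) x.

Definition zero_ext01 u : R -> R := u \_ `[0, 1].

Definition L2_01 u : Prop := zero_ext01 u \in Lfun lebesgue_measure 2%:E.

Definition l2norm u : R :=
  fine ('N[lebesgue_measure]_2%:E[EFin \o zero_ext01 u])%E.

Definition l2dot u v : R := \int[lebesgue_measure]_(x in `[0, 1]) (u x * v x).

Definition L2_neighborhood (s : R -> R) (W : set (R -> R)) : Prop :=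
  L2_01 s /\
  exists2 r : R, 0 < r & forall u, L2_01 u -> l2norm (u \- s) < r -> W u.

Definition test_function (phi : R -> R) : Prop :=
  (forall (k : nat) (x : R), derivable (derive1n k phi) x 1) /\
  exists a b : R, [/\ 0 < a, b < 1 & forall x, x \notin `[a, b] -> phi x = 0].

Definition weak_derivative f g : Prop :=
  forall phi : R -> R, test_function phi -> l2dot f (derive1 phi) = - l2dot g phi.

(* An element of H^1(]0, 1[) is represented by its continuous representative,
   the one to which the supremum over [0, 1] refers. *)
Definition sobolev_constant (C : R) : Prop :=
  forall f g : R -> R,
    L2_01 f -> L2_01 g -> weak_derivative f g ->
    {within `[0, 1], continuous f} ->
    forall x : R, x \in `[0, 1] ->
      `|f x| <= C * Num.sqrt (l2norm f ^+ 2 + l2norm g ^+ 2).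

Definition neumann_eigensystem (V : R -> R) (mu : nat -> R)
    (e : nat -> R -> R) : Prop :=
  [/\ [/\ 0 < mu 0%N, mu 0%N < mu 1%N & forall n, mu n <= mu n.+1],
      forall n,
        [/\ forall x, x \in `[0, 1] ->
              [/\ derivable01 (e n) x, derivable01 (D01 (e n)) x &
                  - D01 (D01 (e n)) x + V x * e n x = mu n * e n x],
            D01 (e n) 0 = 0 & D01 (e n) 1 = 0],
      forall i j, l2dot (e i) (e j) = (i == j)%:R,
      (* completeness *)
      forall f, L2_01 f -> (forall n, l2dot (e n) f = 0) ->
        {ae lebesgue_measure, forall x, x \in `[0, 1] -> f x = 0} &
      forall x, x \in `[0, 1] -> 0 < e 0%N x].

(* The Burgers flow maps u0 to u t, where u is the solution with datum u0.
   Being classical for t > 0 includes the joint continuity of u, u_x and u_xx on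
   ]0, oo[ x [0, 1], hence that of u_t on ]0, oo[ x ]0, 1[ by the equation. *)
Definition burgers_solution (V u0 : R -> R) (u : R -> R -> R) : Prop :=
  [/\ [/\ forall t, 0 <= t -> L2_01 (u t),
          forall s, 0 <= s ->
            l2norm (u t \- u s) @[t --> within `[0, +oo[ (nbhs s)] --> 0 &
          {ae lebesgue_measure, forall x, x \in `[0, 1] -> u 0 x = u0 x}],
      forall t, 0 < t -> smooth01 (u t),
      forall k : nat, (k <= 2)%N ->
        {within [set p : R * R | 0 < p.1 /\ p.2 \in `[0, 1]],
          continuous (fun p : R * R => iter k D01 (u p.1) p.2)},
      forall t x, 0 < t -> x \in `]0, 1[ ->
        derivable (u ^~ x) t 1 /\
        derive1 (u ^~ x) t + u t x * D01 (u t) x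
          = D01 (D01 (u t)) x + 2 * D01 V x &
      forall t, 0 < t -> u t 0 = 0 /\ u t 1 = 0].

Definition cole_hopf u (x : R) : R :=
  let E y := expR (- 2^-1 * \int[lebesgue_measure]_(s in `[0, y]) u s) in
  E x / \int[lebesgue_measure]_(y in `[0, 1]) E y.

Section koopman.
Variables (mu : nat -> R) (e : nat -> R -> R) (C1 : R).

Definition f0tilde (x : R) : R :=
  e 0%N x / \int[lebesgue_measure]_(y in `[0, 1]) e 0%N y.

Definition m0 : R := inf (e 0%N @` `[0, 1]).

Definition h1 (t : R) : R :=
  C1 * Num.sqrt (limn (fun N : nat =>
    \sum_(1 <= n < N) (1 + mu n) * expR (- 2 * (mu n - mu 0%N) * t))).

Definition h1_inv : R -> R := 'pinv_(fun=> 0) `]0, +oo[ h1.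

Definition tau_burgers (u0 : R -> R) : R :=
  let d := l2norm (cole_hopf u0 \- f0tilde) in
  if d == 0 then 0 else h1_inv (m0 ^+ 2 / d).

Definition koopman_lambda (nu : seq nat) : R :=
  \sum_(q <- nu) (mu q - mu 0%N).

Definition koopman_phi (nu : seq nat) (u0 : R -> R) : R :=
  \prod_(q <- nu) (l2dot (e q) (cole_hopf u0) / l2dot (e 0%N) (cole_hopf u0)).

(* The mode a_nu for nu = q0 :: q. *)
Definition koopman_mode (q0 : nat) (q : seq nat) (x : R) : R :=
  2 * (- 1) ^+ (size q).+1 * (D01 (e q0) x / e 0%N x)
    * \prod_(i <- q) (e i x / e 0%N x).

Definition koopman_term (u0 : R -> R) (t x : R) (q0 : nat) (q : seq nat) : R :=
  expR (- koopman_lambda (q0 :: q) * t) * koopman_phi (q0 :: q) u0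
    * koopman_mode q0 q x.

(* The innermost sum, over the multi-indices of length m with nonzero entries,
   is the unordered (net of finite partial sums) sum; the sums over m and then
   over q0 are ordinary series. *)
Definition koopman_decomposition (u0 : R -> R) (t x l : R) : Prop :=
  exists (S2 : nat -> nat -> R) (S1 : nat -> R),
    [/\ forall q0 m : nat,
          summability.partial_sum
            (fun q : m.-tuple {n : nat | n != 0%N} =>
               koopman_term u0 t x q0 (map val q))
            @ summability.totally --> S2 q0 m,
        forall q0 : nat, series (S2 q0) @ \oo --> S1 q0 &
        series S1 @ \oo --> l].

Definition Omega_burgers (theta0 : R) : set (R -> R) :=
  [set u0 | L2_01 u0 /\
            l2norm (cole_hopf u0 \- f0tilde) < m0 ^+ 2 / h1 theta0].

Definition s0_burgers (x : R) : R := - 2 * D01 (e 0%N) x / e 0%N x.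

End koopman.
End unit_interval.

(* Main.v *)
Require Import Defs.
From HB Require Import structures.
From mathcomp Require Import all_boot all_order all_algebra.
From mathcomp Require Import all_classical all_reals all_analysis.
From mathcomp Require Import measurable_realfun lebesgue_integral_under.
From mathcomp Require Import ring lra.
Import Order.TTheory GRing.Theory Num.Theory.
Import numFieldNormedType.Exports.

Local Open Scope classical_set_scope.
Local Open Scope ring_scope.

Set Implicit Arguments.
Unset Strict Implicit.
Unset Printing Implicit Defensive.

(* Let w(t, x) = exp(- 1/2 * int_0^x u(t)), so that H(u) = w / int w. If u solves
   the Burgers equation then w_t = w_xx - V w + k(t) w with Neumann boundary
   conditions, for a scalar k(t). Hence the coefficients of w(t) on the
   eigenbasis satisfy c_n' = (k - mu_n) c_n, the unknown k disappears from the
   ratios c_n / c_0, and w(t) is proportional to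
   F = sum_n exp(- (mu_n - mu_0) t) phi_n e_n, phi_n = c_n(H(u0)) / c_0(H(u0)).
   Then u = - 2 w_x / w = - 2 F_x / F, and expanding 1 / F = 1 / (e_0 (1 + z)) as
   a geometric series gives the decomposition as soon as |z| < 1, which is what
   the Sobolev inequality yields when h1 t * ||H(u0) - f0|| < m0^2.
   All series converge uniformly because the eigenvalues grow at least linearly;
   this follows from the Sobolev inequality as well. *)

(** The equation holds for t > 0 only, and time 0 is reached in L^2 alone. The ratios c_n / c_0 are
    therefore followed at positive times and carried to 0 by continuity from the right. Equality of
    w(t) and a multiple of F is first obtained almost everywhere, from completeness of the e_n;
    continuity of both sides makes it pointwise inside the interval, where it can be differentiated.
    The square in m0^2 has two sources. Since H(u0) has mass one, c_0(H(u0)) >= m0, whence |phi_n|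
    <= ||H(u0) - f0|| / m0 for n >= 1; dividing the tail of F by e_0 costs the second m0. The weight
    1 + mu_n in h1 bounds the squared H^1 norm of e_n, the gap being the integral of V e_n^2, and
    the 2 in its exponent comes from squaring the coefficients of the tail. *)

Local Notation leb := lebesgue_measure.

(** * Calculus on the unit interval *)

Section Calculus.
Context {R : realType}.
Implicit Types f g F G u v : R -> R.

Definition cont01 f := {within `[0, 1], continuous f}.

Lemma in01W (x : R) : x \in `]0, 1[ -> x \in `[0, 1].
Proof. exact: subset_itv_oo_cc. Qed.

Lemma zero_in01 : (0 : R) \in `[0, 1].
Proof. by rewrite in_itv /= lexx ler01. Qed.

Lemma one_in01 : (1 : R) \in `[0, 1].
Proof. by rewrite in_itv /= lexx ler01. Qed.

Lemma cont01P f : cont01 f <->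
  forall x : R, x \in `[0, 1] -> f y @[y --> within `[0, 1] (nbhs x)] --> f x.
Proof. exact: subspace_continuousP. Qed.

Lemma eq_cont01 f g : {in `[0, 1], f =1 g} -> cont01 f -> cont01 g.
Proof.
by move=> fg; apply: subspace_eq_continuous => x; rewrite inE => /fg.
Qed.

Lemma cont01_cst (c : R) : cont01 (fun=> c).
Proof. by move=> x; exact: cvg_cst. Qed.

Lemma cont01D f g : cont01 f -> cont01 g -> cont01 (fun x => f x + g x).
Proof. by move=> cf cg x; exact: cvgD (cf x) (cg x). Qed.

Lemma cont01M f g : cont01 f -> cont01 g -> cont01 (fun x => f x * g x).
Proof. by move=> cf cg x; exact: cvgM (cf x) (cg x). Qed.

Lemma cont01N f : cont01 f -> cont01 (fun x => - f x).
Proof. by move=> cf x; exact: cvgN (cf x). Qed.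

Lemma cont01B f g : cont01 f -> cont01 g -> cont01 (fun x => f x - g x).
Proof. by move=> cf cg; apply: cont01D => //; exact: cont01N. Qed.

Lemma cont01_comp (h f : R -> R) : continuous h -> cont01 f -> cont01 (h \o f).
Proof. by move=> ch cf x; exact: cvg_comp (cf x) (ch (f x)). Qed.

Lemma cont01_sum I (r : seq I) (f : I -> R -> R) :
  (forall i, cont01 (f i)) -> cont01 (fun x => \sum_(i <- r) f i x).
Proof.
move=> cf; elim: r => [|i r IH].
  by under eq_fun do rewrite big_nil; exact: cont01_cst.
by under eq_fun do rewrite big_cons; exact: cont01D.
Qed.

Lemma cont01_bounded f : cont01 f ->
  exists2 M, 0 < M & forall x : R, x \in `[0, 1] -> `|f x| <= M.
Proof.
move=> cf.
have cnf : cont01 (fun x => `|f x|) by move=> x; apply: cvg_norm; exact: cf.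
have [c _ Hc] := EVT_max ler01 cnf.
exists (`|f c| + 1); first by rewrite ltr_wpDl.
by move=> x /Hc; lra.
Qed.

Lemma subitv01 (x : R) : x \in `[0, 1] -> `[0, x]%classic `<=` `[0, 1]%classic.
Proof.
rewrite in_itv /= => /andP[_ x1] y /=; rewrite !in_itv /= => /andP[-> yx] /=.
exact: le_trans yx x1.
Qed.

Lemma integrableS01 f x : x \in `[0, 1] ->
  leb.-integrable `[0, 1] (EFin \o f) -> leb.-integrable `[0, x] (EFin \o f).
Proof. by move=> x01; apply: integrableS => //; exact: subitv01. Qed.

Lemma cont01_integrable f : cont01 f -> leb.-integrable `[0, 1] (EFin \o f).
Proof. by apply: continuous_compact_integrable; exact: segment_compact. Qed.

(** The derivative is taken at interior points only, with continuity of both functions up to the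
    ends. The fundamental theorem and integration by parts ask for no more, and no one-sided limit
    has to be computed for a sum of a series. *)
Definition C1_01 F f :=
  [/\ cont01 F, cont01 f & forall x : R, x \in `]0, 1[ -> is_derive x 1 F (f
    x)].

Lemma C1_01_LR F f : C1_01 F f -> derivable_oo_LRcontinuous F 0 1.
Proof.
case=> cF _ dF; have [_ c0 c1] := (continuous_within_itvP _ ltr01).1 cF.
by split=> // x /dF [].
Qed.

Lemma C1_01_derive1 F f : C1_01 F f -> {in `]0, 1[, derive1 F =1 f}.
Proof. by case=> _ _ dF x /dF df; rewrite derive1E derive_val. Qed.

Lemma eq_C1_01 F f g : {in `[0, 1], f =1 g} -> C1_01 F f -> C1_01 F g.
Proof.
move=> fg [cF cf dF]; split=> //; first exact: eq_cont01 cf.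
by move=> x x01; rewrite -fg ?in01W//; exact: dF.
Qed.

Lemma C1_01_FTC F f x : C1_01 F f -> x \in `[0, 1] ->
  \int[leb]_(s in `[0, x]) f s = F x - F 0.
Proof.
move=> CF; rewrite in_itv /= le_eqVlt => /andP[/predU1P[<- _|x0 x1]].
  by rewrite set_itv1 Rintegral_set1 subrr.
have [cF cf dF] := CF.
have sub : `[0, x]%classic `<=` `[0, 1]%classic.
  by apply: subitv01; rewrite in_itv /= x1 ltW.
have subo y : y \in `]0, x[ -> y \in `]0, 1[.
  by rewrite !in_itv /= => /andP[-> yx]; exact: lt_le_trans yx x1.
rewrite /Rintegral (@continuous_FTC2 _ f F)//.
- exact: continuous_subspaceW sub cf.
- have := continuous_subspaceW sub cF.
  move=> /(continuous_within_itvP _ x0)[_ c0 cx].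
  by split=> // y /subo /dF [].
- by move=> y /subo; exact: C1_01_derive1.
Qed.

Lemma C1_01D F f G g : C1_01 F f -> C1_01 G g ->
  C1_01 (fun x => F x + G x) (fun x => f x + g x).
Proof.
move=> [cF cf dF] [cG cg dG]; split; [exact: cont01D..|].
by move=> x x01; apply: is_deriveD; [exact: dF|exact: dG].
Qed.

Lemma C1_01Z (c : R) F f : C1_01 F f ->
  C1_01 (fun x => c * F x) (fun x => c * f x).
Proof.
move=> [cF cf dF]; split; [by apply: cont01M => //; exact: cont01_cst..|].
by move=> x x01; apply: is_deriveZ; exact: dF.
Qed.

Lemma C1_01M F f G g : C1_01 F f -> C1_01 G g ->
  C1_01 (fun x => F x * G x) (fun x => F x * g x + f x * G x).
Proof.
move=> [cF cf dF] [cG cg dG]; split.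
- exact: cont01M.
- by apply: cont01D; exact: cont01M.
- move=> x x01; have := is_deriveM (dF _ x01) (dG _ x01).
  by rewrite /GRing.scale /= [f x * _]mulrC.
Qed.

Lemma C1_01_cst (c : R) : C1_01 (fun=> c) (fun=> 0).
Proof. by split; [exact: cont01_cst..|move=> x _; exact: is_derive_cst]. Qed.

Lemma C1_01_sum I (r : seq I) (F f : I -> R -> R) :
  (forall i, C1_01 (F i) (f i)) ->
  C1_01 (fun x => \sum_(i <- r) F i x) (fun x => \sum_(i <- r) f i x).
Proof.
move=> CF; elim: r => [|i r IH].
  under eq_fun do rewrite big_nil.
  under [X in C1_01 _ X]eq_fun do rewrite big_nil.
  exact: C1_01_cst.
under eq_fun do rewrite big_cons.
under [X in C1_01 _ X]eq_fun do rewrite big_cons.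
exact: C1_01D.
Qed.

(** The two points come in either order. The bound on [c - x] is what yields a quadratic remainder
    in [fun_series_C1]. *)
Lemma C1_01_mean_value F f : C1_01 F f ->
  forall x y : R, x \in `[0, 1] -> y \in `[0, 1] ->
  exists c : R, [/\ c \in `[0, 1], `|c - x| <= `|y - x| &
                F y - F x = f c * (y - x)].
Proof.
move=> [cF cf dF].
have W (x y : R) : x \in `[0, 1] -> y \in `[0, 1] -> x <= y ->
    exists2 c, x <= c <= y & F y - F x = f c * (y - x).
  move=> x01 y01 xy.
  have sub : `[x, y]%classic `<=` `[0, 1]%classic.
    move: x01 y01; rewrite !in_itv /= => /andP[x0 _] /andP[_ y1] z /=.
    rewrite !in_itv /= => /andP[xz zy].
    by rewrite (le_trans x0 xz) (le_trans zy y1).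
  have cFxy : {within `[x, y], continuous F} by exact: continuous_subspaceW cF.
  have dFxy (z : R) : z \in `]x, y[ -> is_derive z 1 F (f z).
    move: x01 y01; rewrite !in_itv /= => /andP[x0 _] /andP[_ y1].
    move=> /andP[xz zy]; apply: dF; rewrite in_itv /=.
    by rewrite (le_lt_trans x0 xz) (lt_le_trans zy y1).
  have [c cxy ->] := @MVT_segment R F f x y xy dFxy cFxy.
  by exists c => //; move: cxy; rewrite in_itv.
move=> x y x01 y01.
have /andP[x0 x1] : 0 <= x <= 1 by move: x01; rewrite in_itv.
have /andP[y0 y1] : 0 <= y <= 1 by move: y01; rewrite in_itv.
have [xy|/ltW yx] := leP x y.
  have [c /andP[xc cy] E] := W _ _ x01 y01 xy; exists c; split => //.
    by rewrite in_itv /= (le_trans x0 xc) (le_trans cy y1).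
  by rewrite !ger0_norm ?subr_ge0// lerD2r.
have [c /andP[yc cx] E] := W _ _ y01 x01 yx; exists c; split => //.
  by rewrite in_itv /= (le_trans y0 yc) (le_trans cx x1).
  by rewrite !ler0_norm ?subr_le0// lerN2 lerD2r.
by rewrite -opprB E -mulrN opprB.
Qed.

Lemma C1_01_lipschitz F f M : C1_01 F f ->
  (forall x : R, x \in `[0, 1] -> `|f x| <= M) ->
  forall x y : R, x \in `[0, 1] -> y \in `[0, 1] ->
    `|F y - F x| <= M * `|y - x|.
Proof.
move=> CF fM x y x01 y01; have [c [c01 _ ->]] := C1_01_mean_value CF x01 y01.
by rewrite normrM ler_wpM2r// fM.
Qed.

Lemma C1_01_eq_derive F f G g : C1_01 F f -> C1_01 G g ->
  {in `]0, 1[, F =1 G} -> {in `]0, 1[, f =1 g}.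
Proof.
move=> [_ _ dF] [_ _ dG] FG x x01; have df := dF x x01; have dg := dG x x01.
rewrite -(@derive_val _ _ _ _ _ _ _ df) -(@derive_val _ _ _ _ _ _ _ dg).
apply: near_eq_derive; near=> y.
by apply: FG; near: y; exact: near_in_itvoo.
Unshelve. all: by end_near. Qed.

Lemma C1_01_ibp F f G g : C1_01 F f -> C1_01 G g ->
  l2dot F g = F 1 * G 1 - F 0 * G 0 - l2dot f G.
Proof.
move=> CF CG; have [cF cf _] := CF; have [cG cg _] := CG.
rewrite /l2dot; apply: Rintegration_by_parts => //.
- exact: C1_01_LR CF.
- exact: C1_01_derive1.
- exact: C1_01_LR CG.
- exact: C1_01_derive1.
Qed.

End Calculus.

(** * Square-integrable functions *)

Section L2.
Context {R : realType}.
Implicit Types f g u v : R -> R.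

Lemma cont01_measurable f : cont01 f -> measurable_fun `[0 : R, 1] f.
Proof. by move=> /cont01_integrable /integrableP[/measurable_EFinP]. Qed.

Lemma zero_ext01_sqr u :
  (fun x => zero_ext01 u x ^+ 2) = (fun x => u x ^+ 2) \_ `[0, 1].
Proof.
apply/funext => x /=; rewrite /zero_ext01 /patch.
by case: ifPn => // _; rewrite expr0n.
Qed.

Lemma l2norm_poweR u :
  ('N[leb]_2%:E[EFin \o zero_ext01 u] `^ 2 =
   \int[leb]_(x in `[0%R, 1%R]) (u x ^+ 2)%:E)%E.
Proof.
rewrite poweR_Lnorm ?pnatr_eq0// [RHS]integral_mkcond.
rewrite restrict_EFin -zero_ext01_sqr; apply: eq_integral => x _ /=.
by rewrite -(@real_normK _ (zero_ext01 u x)) ?num_real// -powR_mulrn.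
Qed.

Lemma L2_01P u : L2_01 u <->
  measurable_fun `[0 : R, 1] u /\
  leb.-integrable `[0, 1] (EFin \o (fun x => u x ^+ 2)).
Proof.
have mI : measurable `[0%R, 1%R : R] by [].
rewrite /L2_01 /zero_ext01; split.
  move=> uL; have /Lfun2_integrable_sqr iu := uL; split.
    by apply/(measurable_restrictT _ mI); move: uL; rewrite inE =>
      /andP[/[!inE]].
  move: iu; rewrite zero_ext01_sqr -restrict_EFin.
  by move=> /(integrable_restrict leb mI measurableT); rewrite setTI.
case=> mu iu; rewrite inE; apply/andP; split.
  by rewrite inE; apply/(measurable_restrictT _ mI).
rewrite inE /= /finite_norm.
have := l2norm_poweR u; rewrite /zero_ext01.
have : (\int[leb]_(x in `[0%R, 1%R]) (u x ^+ 2)%:E < +oo)%E.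
  move/integrableP: iu => [_]; apply: le_lt_trans.
  by apply: ge0_le_integral => //=; [
    move=> x _; rewrite lee_fin sqr_ge0
  | apply/measurable_EFinP; exact: measurable_funX
  | apply/measurable_EFinP/measurableT_comp => //; exact: measurable_funX
  | move=> x _; rewrite lee_fin ler_norm].
by move=> + E; rewrite -E => /lty_poweRy; apply; rewrite pnatr_eq0.
Qed.

Lemma L2_01_measurable u : L2_01 u -> measurable_fun `[0 : R, 1] u.
Proof. by move=> /L2_01P[]. Qed.

Lemma cont01_L2 f : cont01 f -> L2_01 f.
Proof.
move=> cf; apply/L2_01P; split; first exact: cont01_measurable.
by apply: cont01_integrable; exact: cont01M.
Qed.

Lemma integrable01D f g : leb.-integrable `[0, 1] (EFin \o f) ->
  leb.-integrable `[0, 1] (EFin \o g) ->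
  leb.-integrable `[0, 1] (EFin \o (fun x => f x + g x)).
Proof.
move=> fi gi; rewrite (_ : _ \o _ = (EFin \o f) \+ (EFin \o g))%E//.
exact: integrableD.
Qed.

Lemma integrable01Z (c : R) f : leb.-integrable `[0, 1] (EFin \o f) ->
  leb.-integrable `[0, 1] (EFin \o (fun x => c * f x)).
Proof.
move=> fi; rewrite (_ : _ \o _ = (fun x => c%:E * (EFin \o f) x))%E//.
exact: integrableZl.
Qed.

Lemma L2_01_mul_integrable u v : L2_01 u -> L2_01 v ->
  leb.-integrable `[0, 1] (EFin \o (fun x => u x * v x)).
Proof.
move=> /L2_01P[mu iu] /L2_01P[mv iv].
have iuv := integrable01D iu iv.
apply: le_integrable iuv => //.
  by apply/measurable_EFinP; exact: measurable_funM.
move=> x _ /=; rewrite lee_fin normrM [leRHS]ger0_norm; last first.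
  by rewrite addr_ge0// sqr_ge0.
rewrite -(@real_normK _ (u x)) ?num_real// -(@real_normK _ (v x)) ?num_real//.
have := sqr_ge0 (`|u x| - `|v x|); have := normr_ge0 (u x).
have := normr_ge0 (v x); clear; nra.
Qed.

Lemma L2_01_integrable u : L2_01 u -> leb.-integrable `[0, 1] (EFin \o u).
Proof.
move=> uL; have c1 : L2_01 (fun=> 1 : R) by exact/cont01_L2/cont01_cst.
have := L2_01_mul_integrable uL c1.
by congr (integrable _ _ (EFin \o _)); apply/funext => x; rewrite mulr1.
Qed.

Lemma L2_01D u v : L2_01 u -> L2_01 v -> L2_01 (fun x => u x + v x).
Proof.
move=> uL vL; have /L2_01P[mu iu] := uL; have /L2_01P[mv iv] := vL.
apply/L2_01P; split; first exact: measurable_funD.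
have iuv := L2_01_mul_integrable uL vL.
have := integrable01D (integrable01D iu (integrable01Z 2 iuv)) iv.
congr (integrable _ _ (EFin \o _)); apply/funext => x.
by rewrite sqrrD mulr_natl.
Qed.

Lemma L2_01Z (c : R) u : L2_01 u -> L2_01 (fun x => c * u x).
Proof.
move=> /L2_01P[mu iu]; apply/L2_01P; split.
  by apply: measurable_funM.
have := integrable01Z (c ^+ 2) iu.
by congr (integrable _ _ (EFin \o _)); apply/funext => x; rewrite exprMn.
Qed.

Lemma L2_01B u v : L2_01 u -> L2_01 v -> L2_01 (fun x => u x - v x).
Proof.
move=> uL /(L2_01Z (-1)) vL; have := L2_01D uL vL.
by under eq_fun do rewrite mulN1r.
Qed.

Lemma l2norm_ge0 u : 0 <= l2norm u.
Proof. exact/fine_ge0/Lnorm_ge0. Qed.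

Lemma l2norm_sqr u : L2_01 u -> l2norm u ^+ 2 = l2dot u u.
Proof.
move=> uL; have := l2norm_poweR u.
have : (0 <= 'N[leb]_2%:E[EFin \o zero_ext01 u] < +oo)%E.
  have /andP[_] : zero_ext01 u \in Lfun leb 2%:E := uL.
  by rewrite inE Lnorm_ge0.
rewrite /l2norm /l2dot /Rintegral; case: Lnorm =>
  [r /andP[r0 _] <-|/andP[_]|/andP[]]; last 2 first.
- by rewrite ltxx.
- by rewrite leNgt ltNyr.
by rewrite /= powR_mulrn.
Qed.

Lemma l2dotC u v : l2dot u v = l2dot v u.
Proof. by apply: eq_Rintegral => x _; rewrite mulrC. Qed.

Lemma eq_l2dot u v u' v' : {in `[0, 1], u =1 u'} -> {in `[0, 1], v =1 v'} ->
  l2dot u v = l2dot u' v'.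
Proof.
by move=> uu vv; apply: eq_Rintegral => x; rewrite inE => x01; rewrite uu ?vv.
Qed.

Lemma l2dotDr u v w : L2_01 u -> L2_01 v -> L2_01 w ->
  l2dot u (fun x => v x + w x) = l2dot u v + l2dot u w.
Proof.
move=> uL vL wL; rewrite -RintegralD//; [|exact: L2_01_mul_integrable..].
by apply: eq_Rintegral => x _; rewrite mulrDr.
Qed.

Lemma l2dotZr (c : R) u v : L2_01 u -> L2_01 v ->
  l2dot u (fun x => c * v x) = c * l2dot u v.
Proof.
move=> uL vL; rewrite -RintegralZl//; last exact: L2_01_mul_integrable.
by apply: eq_Rintegral => x _; rewrite mulrCA.
Qed.

Lemma l2dotBr u v w : L2_01 u -> L2_01 v -> L2_01 w ->
  l2dot u (fun x => v x - w x) = l2dot u v - l2dot u w.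
Proof.
move=> uL vL wL; rewrite -RintegralB//; [|exact: L2_01_mul_integrable..].
by apply: eq_Rintegral => x _; rewrite mulrBr.
Qed.

Lemma l2dot_sumr I (r : seq I) u (v : I -> R -> R) :
  L2_01 u -> (forall i, L2_01 (v i)) ->
  l2dot u (fun x => \sum_(i <- r) v i x) = \sum_(i <- r) l2dot u (v i).
Proof.
move=> uL vL.
have sL s : L2_01 (fun x => \sum_(i <- s) v i x).
  elim: s => [|i s IH].
    by under [X in L2_01 X]eq_fun do rewrite big_nil;
      exact/cont01_L2/cont01_cst.
  by under [X in L2_01 X]eq_fun do rewrite big_cons; exact: L2_01D.
elim: r => [|i r IH].
  rewrite big_nil /l2dot; under eq_Rintegral do rewrite big_nil mulr0.
  by rewrite Rintegral_cst// mul0r.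
under [X in l2dot _ X]eq_fun do rewrite big_cons.
by rewrite big_cons -IH l2dotDr.
Qed.

Lemma l2dot_CS u v : L2_01 u -> L2_01 v -> `|l2dot u v| <= l2norm u * l2norm v.
Proof.
move=> uL vL.
have pos s : 0 <= l2norm u ^+ 2 - 2 * s * l2dot u v + s ^+ 2 * l2norm v ^+ 2.
  have svL := L2_01Z s vL; have wL := L2_01B uL svL.
  have : 0 <= l2dot (fun x => u x - s * v x) (fun x => u x - s * v x).
    by apply: Rintegral_ge0 => x _; exact: sqr_ge0.
  rewrite l2dotBr// l2dotZr// ![l2dot (fun x => u x - s * v x) _]l2dotC.
  rewrite !l2dotBr// !l2dotZr// -!l2norm_sqr// [l2dot v u]l2dotC.
  by set A := l2norm u; set B := l2norm v; set C := l2dot u v; clearbody A B C;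
    clear; lra.
have nu := l2norm_ge0 u; have nv := l2norm_ge0 v.
rewrite -(@ler_pXn2r _ 2)// ?nnegrE ?mulr_ge0// real_normK ?num_real//.
move: nu nv pos; set A := l2norm u; set B := l2norm v; set C := l2dot u v.
clearbody A B C; clear => A0 B0 pos; have [B_0|Bn0] := eqVneq B 0.
  suff -> : C = 0 by rewrite expr0n /= sqr_ge0.
  apply/eqP; apply/negP => /negP C0.
  (* With [B = 0] the quadratic in [s] is affine; this [s] makes its value -1. Otherwise its
     minimiser [C / B ^+ 2] is used below. *)
  have := pos ((A ^+ 2 + 1) / (2 * C)).
  rewrite B_0 expr0n /= mulr0 addr0.
  have -> : 2 * ((A ^+ 2 + 1) / (2 * C)) * C = A ^+ 2 + 1 by field.
  by lra.
have := pos (C / B ^+ 2).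
have -> : A ^+ 2 - 2 * (C / B ^+ 2) * C + (C / B ^+ 2) ^+ 2 * B ^+ 2 =
  A ^+ 2 - C ^+ 2 / B ^+ 2 by field.
by rewrite subr_ge0 ler_pdivrMr ?exprn_even_gt0// exprMn.
Qed.

Lemma l2norm_le_sup f M : cont01 f -> 0 <= M ->
  (forall x : R, x \in `[0, 1] -> `|f x| <= M) -> l2norm f <= M.
Proof.
move=> cf M0 fM; rewrite -(@ler_pXn2r _ 2)// ?nnegrE ?l2norm_ge0//.
rewrite l2norm_sqr; last exact: cont01_L2.
have -> : M ^+ 2 = \int[leb]_(x in `[0%R, 1%R : R]) (M ^+ 2).
  by rewrite Rintegral_cst//= lebesgue_measure_itv/= lte_fin ltr01 sube0 mulr1.
apply: le_Rintegral => //.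
- by apply: cont01_integrable; exact: cont01M.
- by apply: cont01_integrable; exact: cont01_cst.
- move=> x x01; rewrite -expr2 -real_normK ?num_real//.
  by rewrite ler_pXn2r// ?nnegrE//; exact: fM.
Qed.

(** Cauchy-Schwarz against the constant 1. It turns L^2 closeness of two functions into uniform
    closeness of their primitives, hence of their Cole-Hopf transforms. *)
Lemma Rintegral_le_l2norm u x : L2_01 u -> x \in `[0, 1] ->
  `|\int[leb]_(s in `[0, x]) u s| <= l2norm u.
Proof.
move=> uL x01; have iu := L2_01_integrable uL.
have inu : leb.-integrable `[0, 1] (EFin \o (fun x => `|u x|)).
  exact: (integrable_norm iu).
apply: (le_trans (le_normr_Rintegral _ _)) => //.
  exact: integrableS01.
apply: (@le_trans _ _ (\int[leb]_(s in `[0, 1]) `|u s|)).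
  rewrite [leLHS](_ : _ = \int[leb]_(s in `[0, 1])
      (((fun s => `|u s|) \_ `[0, x]) s)); last first.
    rewrite -[RHS]Rintegral_mkcondr; congr Rintegral.
    by apply/esym/setIidPr; exact: subitv01.
  apply: le_Rintegral => //.
    rewrite -restrict_EFin; apply/integrable_restrict => //.
    have /setIidPr -> := subitv01 x01; exact: integrableS01.
  by move=> y _; rewrite /patch; case: ifPn => // _; exact: normr_ge0.
have nuL : L2_01 (fun x => `|u x|).
  move: uL => /L2_01P[mu iu2]; apply/L2_01P; split.
    exact: measurableT_comp.
  by apply: eq_integrable iu2 => // s _ /=; rewrite real_normK ?num_real.
have c1 : cont01 (fun=> 1 : R) by exact: cont01_cst.
have := l2dot_CS nuL (cont01_L2 c1).
have n1 : l2norm (fun=> 1 : R) <= 1.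
  by apply: l2norm_le_sup => // y _; rewrite normr1.
have -> : l2norm (fun x => `|u x|) = l2norm u.
  apply/eqP; rewrite -(@eqrXn2 _ 2)// ?l2norm_ge0// !l2norm_sqr//; apply/eqP.
  by apply: eq_Rintegral => s _; rewrite -!expr2 real_normK ?num_real.
rewrite /l2dot; under eq_Rintegral do rewrite mulr1.
move=> /(le_trans (ler_norm _)) /le_trans; apply.
by rewrite ler_piMr// l2norm_ge0.
Qed.

Lemma ae_eq_Rintegral01 u v x : measurable_fun `[0 : R, 1] u ->
  measurable_fun `[0 : R, 1] v ->
  {ae leb, forall x : R, x \in `[0, 1] -> u x = v x} -> x \in `[0, 1] ->
  \int[leb]_(s in `[0, x]) u s = \int[leb]_(s in `[0, x]) v s.
Proof.
move=> mu mv uv x01; rewrite /Rintegral; congr fine.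
apply: ae_eq_integral => //.
- by apply/measurable_EFinP; apply: measurable_funS mu => //; exact: subitv01.
- by apply/measurable_EFinP; apply: measurable_funS mv => //; exact: subitv01.
- apply: filterS uv; first exact: (ae_filter_ringOfSetsType leb).
  by move=> y H /(subitv01 x01) /H /= ->.
Qed.

Definition prim01 f x := \int[leb]_(s in `[0, x]) f s.

Lemma prim01_0 f : prim01 f 0 = 0.
Proof. by rewrite /prim01 set_itv1 Rintegral_set1. Qed.

Lemma prim01_cont f : leb.-integrable `[0, 1] (EFin \o f) -> cont01 (prim01 f).
Proof. by move=> fi; exact: (parameterized_integral_continuous ler01 fi). Qed.

Lemma prim01_C1 f : cont01 f -> C1_01 (prim01 f) f.
Proof.
move=> cf; have fi := cont01_integrable cf; split => //.
  exact: prim01_cont.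
move=> x; rewrite in_itv /= => /andP[x0 x1].
have [cfo _ _] := (continuous_within_itvP _ ltr01).1 cf.
have fx : {for x, continuous f} by apply: cfo; rewrite in_itv /= x0.
have [dF F'] := continuous_FTC1_closed x1 fi x0 fx.
by apply: DeriveDef => //; rewrite -derive1E.
Qed.

(** The primitives coincide everywhere, and differentiating them recovers the two functions at
    interior points. *)
Lemma cont01_eq_oo f g : cont01 f -> cont01 g ->
  {ae leb, forall x : R, x \in `[0, 1] -> f x = g x} ->
  {in `]0, 1[, f =1 g}.
Proof.
move=> cf cg fg x x01.
apply: (C1_01_eq_derive (prim01_C1 cf) (prim01_C1 cg)) => // y /in01W y01.
by apply: ae_eq_Rintegral01 => //; exact: cont01_measurable.
Qed.

End L2.

(** * One-sided derivatives and the Sobolev inequality *)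

Section Derivatives.
Context {R : realType}.
Implicit Types f g u v : R -> R.

Lemma derivable01P f (x : R) : derivable01 f x ->
  forall eps, 0 < eps -> exists2 d, 0 < d & forall y : R, y \in `[0, 1] ->
    `|y - x| < d -> `|f y - f x - D01 f x * (y - x)| <= eps * `|y - x|.
Proof.
move=> df eps eps0.
have /cvgrPdist_le/(_ eps eps0) : diff_quot01 f x --> D01 f x by [].
rewrite ?near_simpl => -[d /= d0 H]; exists d => // y y01 yx.
have [->|ynx] := eqVneq y x; first by rewrite !subrr mulr0 subr0 normr0 mulr0.
have /H/(_ ynx)/(_ y01) : ball x d y by rewrite /ball /= distrC.
have yx0 : y - x != 0 by rewrite subr_eq0.
have -> : D01 f x - (f y - f x) / (y - x) =
    - (f y - f x - D01 f x * (y - x)) / (y - x) by field.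
by rewrite normrM normrN normfV ler_pdivrMr ?normr_gt0.
Qed.

Lemma derivable01_cont f :
  (forall x : R, x \in `[0, 1] -> derivable01 f x) -> cont01 f.
Proof.
move=> df; apply/cont01P => x x01; apply/cvgrPdist_le => eps eps0.
have [d d0 Hd] := derivable01P (df _ x01) ltr01.
have K0 : 0 < `|D01 f x| + 1 by rewrite ltr_wpDl.
rewrite ?near_simpl; exists (Num.min d (eps / (`|D01 f x| + 1))) => /=.
  by rewrite lt_min d0 divr_gt0.
move=> y; rewrite /ball /= distrC lt_min => /andP[yd ye] y01.
have := Hd y y01 yd; rewrite mul1r [`|f x - f y|]distrC.
move: ye; rewrite ltr_pdivlMr// => ye HA.
rewrite -(subrK (D01 f x * (y - x)) (f y - f x)).
apply: (le_trans (ler_normD _ _)); rewrite normrM.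
apply: (@le_trans _ _ (`|y - x| * (`|D01 f x| + 1))); last exact: ltW.
by rewrite [leRHS]mulrDr mulr1 addrC [`|D01 f x| * _]mulrC lerD2l.
Qed.

(** A first-order estimate restricted to [0, 1] suffices at an interior point. Both [D01] and
    termwise differentiation of series produce such an estimate. *)
Lemma is_derive_of_estimate f (x l : R) : x \in `]0, 1[ ->
  (forall eps, 0 < eps -> exists2 d, 0 < d & forall y : R, y \in `[0, 1] ->
    `|y - x| < d -> `|f y - f x - l * (y - x)| <= eps * `|y - x|) ->
  is_derive x 1 f l.
Proof.
move=> x01 df.
suff H : h^-1 *: (f (h *: 1 + x) - f x) @[h --> 0^'] --> l.
  apply: DeriveDef; first by apply/cvg_ex; exists l.
  by rewrite /derive; apply/cvg_lim.
apply/cvgrPdist_le => eps eps0.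
have [d d0 Hd] := df _ eps0.
have [d' /= d'0 Hd'] := near_in_itvoo x01.
exists (Num.min d d') => /=; first by rewrite lt_min d0.
move=> h; rewrite /ball /= sub0r normrN lt_min => /andP[hd hd'] h0.
have hx01 : h + x \in `[0, 1].
  apply: in01W; apply: Hd'.
  by rewrite /ball /= opprD addrCA subrr addr0 normrN.
have := Hd _ hx01; rewrite addrK => /(_ hd).
rewrite /GRing.scale /= mulr1 => H.
have -> : l - h^-1 * (f (h + x) - f x) =
    - (f (h + x) - f x - l * h) / h by field.
by rewrite normrM normrN normfV ler_pdivrMr ?normr_gt0.
Qed.

Lemma derivable01_is_derive f (x : R) : x \in `]0, 1[ -> derivable01 f x ->
  is_derive x 1 f (D01 f x).
Proof.
by move=> x01 df; apply: is_derive_of_estimate => // eps; exact: derivable01P.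
Qed.

Lemma derivable01_C1 f :
  (forall x : R, x \in `[0, 1] -> derivable01 f x) -> cont01 (D01 f) ->
  C1_01 f (D01 f).
Proof.
move=> df cf; split => //; first exact: derivable01_cont.
by move=> x x01; apply: derivable01_is_derive => //; apply: df; exact: in01W.
Qed.

Lemma smooth01_C1 f k : smooth01 f -> C1_01 (iter k D01 f) (iter k.+1 D01 f).
Proof.
move=> sf; apply: derivable01_C1; first exact: sf.
exact/derivable01_cont/(sf k.+1).
Qed.

Lemma smooth01_cont f k : smooth01 f -> cont01 (iter k D01 f).
Proof. by move=> /(smooth01_C1 k)[]. Qed.

Lemma test_function_C1 (phi : R -> R) : test_function phi ->
  [/\ C1_01 phi (derive1 phi), phi 0 = 0 & phi 1 = 0].
Proof.
case=> sphi [a [b [a0 b1 ab]]]; split; last 2 first.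
- by apply: ab; rewrite in_itv /= leNgt a0.
- by apply: ab; rewrite in_itv /= [1 <= b]leNgt b1 andbF.
have cont k : continuous (derive1n k phi).
  by move=> x; apply: differentiable_continuous; apply/derivable1_diffP;
    exact: sphi.
split; [exact/continuous_subspaceT/(cont 0%N)|exact/continuous_subspaceT/(cont
  1%N)|].
move=> x _; apply: DeriveDef; first exact: (sphi 0%N).
by rewrite derive1E.
Qed.

Lemma C1_01_weak_derivative F f : C1_01 F f -> weak_derivative F f.
Proof.
move=> CF phi /test_function_C1[Cphi phi0 phi1].
by rewrite (C1_01_ibp CF Cphi) phi0 phi1 !mulr0 subrr sub0r.
Qed.

Lemma sobolev_C1 (C : R) F f : sobolev_constant C -> C1_01 F f ->
  forall x : R, x \in `[0, 1] ->
    `|F x| <= C * Num.sqrt (l2dot F F + l2dot f f).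
Proof.
move=> sC CF x x01; have [cF cf _] := CF.
rewrite -!l2norm_sqr; try exact: cont01_L2.
apply: sC => //; [exact: cont01_L2..|exact: C1_01_weak_derivative].
Qed.

End Derivatives.

(** * Series of functions *)

Section SeriesOfFunctions.
Context {R : realType}.
Implicit Types (f g : R -> R) (a M : nat -> R).

Lemma cvgn_seriesZ (c : R) a : cvgn (series a) ->
  cvgn (series (fun n => c * a n)).
Proof. exact: (@is_cvg_seriesZ _ a c). Qed.

Lemma lim_seriesZl (c : R) a : cvgn (series a) ->
  limn (series (fun n => c * a n)) = c * limn (series a).
Proof. exact: (@lim_seriesZ _ a c). Qed.

Lemma dominated_series_cvg a M : (forall n, `|a n| <= M n) ->
  cvgn (series M) -> cvgn (series a).
Proof.
move=> aM cM; apply: normed_cvg; apply: series_le_cvg (aM) cM => // n.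
exact: le_trans (normr_ge0 _) (aM n).
Qed.

Lemma dominated_series_norm_cvg a M : (forall n, `|a n| <= M n) ->
  cvgn (series M) -> cvgn (series (fun n => `|a n|)).
Proof.
move=> aM cM; apply: series_le_cvg (aM) cM => // n.
exact: le_trans (normr_ge0 _) (aM n).
Qed.

Lemma dominated_series_le a M : (forall n, `|a n| <= M n) ->
  cvgn (series M) -> `|limn (series a)| <= limn (series M).
Proof.
move=> aM cM; have ca := dominated_series_norm_cvg aM cM.
apply: (le_trans (lim_series_norm ca)); apply: ler_lim => //.
by apply: nearW => n; rewrite /series /=; apply: ler_sum => i _; exact: aM.
Qed.

Lemma dominated_series_tail a M N : (forall n, `|a n| <= M n) ->
  cvgn (series M) ->
  `|limn (series a) - series a N| <= limn (series M) - series M N.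
Proof.
move=> aM cM; have ca := dominated_series_cvg aM cM.
have H1 : (`|series a n - series a N|) @[n --> \oo] -->
    `|limn (series a) - series a N|.
  by apply: cvg_norm; apply: cvgB => //; exact: cvg_cst.
have H2 : (series M n - series M N) @[n --> \oo] -->
    limn (series M) - series M N.
  by apply: cvgB => //; exact: cvg_cst.
apply: (ler_cvg_to H1 H2); near=> n.
have Nn : (N <= n)%N by near: n; exact: nbhs_infty_ge.
rewrite !sub_series_geq//; apply: (le_trans (ler_norm_sum _ _ _)).
by apply: ler_sum => i _; exact: aM.
Unshelve. all: by end_near. Qed.

Definition fun_series (f : nat -> R -> R) (x : R) : R :=
  limn (series (fun n => f n x)).

Lemma lipschitz_within f (a b K : R) :
  (forall x y : R, x \in `[a, b] -> y \in `[a, b] ->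
     `|f y - f x| <= K * `|y - x|) -> {within `[a, b], continuous f}.
Proof.
move=> fK; apply/subspace_continuousP => x xab; apply/cvgrPdist_le => eps eps0.
have K0 : 0 < `|K| + 1 by rewrite ltr_wpDl.
exists (eps / (`|K| + 1)) => /=; first by rewrite divr_gt0.
move=> y; rewrite /ball /= ltr_pdivlMr// distrC => ye yab.
rewrite distrC; apply: (le_trans (fK _ _ xab yab)).
apply: le_trans (ltW ye); rewrite mulrC ler_wpM2l//.
by apply: (le_trans (ler_norm K)); rewrite lerDl.
Qed.

(* Termwise differentiation: Taylor's formula for each term passes to the limit
   because the second derivatives are summable as well. *)
Lemma fun_series_C1 (f f1 f2 : nat -> R -> R) M :
  (forall n, C1_01 (f n) (f1 n)) -> (forall n, C1_01 (f1 n) (f2 n)) ->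
  (forall n (x : R), x \in `[0, 1] ->
     [/\ `|f n x| <= M n, `|f1 n x| <= M n & `|f2 n x| <= M n]) ->
  cvgn (series M) -> C1_01 (fun_series f) (fun_series f1).
Proof.
move=> Cf Cf1 fM cM.
have fM0 n x x01 := let: And3 h _ _ := fM n x x01 in h.
have fM1 n x x01 := let: And3 _ h _ := fM n x x01 in h.
have fM2 n x x01 := let: And3 _ _ h := fM n x x01 in h.
have cf (x : R) (x01 : x \in `[0, 1]) :=
  dominated_series_cvg (fun n => fM0 n x x01) cM.
have cf1 (x : R) (x01 : x \in `[0, 1]) :=
  dominated_series_cvg (fun n => fM1 n x x01) cM.
have lip (g g1 : nat -> R -> R) : (forall n, C1_01 (g n) (g1 n)) ->
    (forall n (x : R), x \in `[0, 1] -> `|g n x| <= M n) ->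
    (forall n (x : R), x \in `[0, 1] -> `|g1 n x| <= M n) ->
    cont01 (fun_series g).
  move=> Cg gM gM1; apply: (@lipschitz_within _ _ _ (limn (series M))) =>
    x y x01 y01.
  have cg z (z01 : z \in `[0, 1]) :=
    dominated_series_cvg (fun n => gM n z z01) cM.
  rewrite /fun_series -(lim_seriesB (cg _ y01) (cg _ x01)).
  rewrite mulrC -(lim_seriesZl _ cM); apply: dominated_series_le; last first.
    exact: cvgn_seriesZ.
  by move=> n; rewrite mulrC; apply: C1_01_lipschitz (Cg n) _ _ _ _ _ => //;
    exact: gM1.
split; [exact: (lip _ _ Cf fM0 fM1)|exact: (lip _ _ Cf1 fM1 fM2)|].
move=> x x01o; have x01 := in01W x01o.
apply: is_derive_of_estimate => // eps eps0.
have S0 : 0 < `|limn (series M)| + 1 by rewrite ltr_wpDl.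
exists (eps / (`|limn (series M)| + 1)); first by rewrite divr_gt0.
move=> y y01; rewrite ltr_pdivlMr// => ye.
have -> : fun_series f y - fun_series f x - fun_series f1 x * (y - x) =
    limn (series (fun n => f n y - f n x - (y - x) * f1 n x)).
  have cd := is_cvg_seriesB (cf _ y01) (cf _ x01).
  have c1 := @cvgn_seriesZ (y - x) _ (cf1 _ x01).
  rewrite -[RHS]/(limn (series ((f ^~ y - f ^~ x) - (fun n =>
    (y - x) * f1 n x)))).
  rewrite (lim_seriesB cd c1) (lim_seriesB (cf _ y01) (cf _ x01)).
  by rewrite (lim_seriesZl _ (cf1 _ x01)) [(y - x) * _]mulrC.
apply: (@le_trans _ _ (limn (series (fun n => (`|y - x| * `|y - x|) * M n)))).
  apply: dominated_series_le; last exact: cvgn_seriesZ.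
  move=> n; have [c [c01 cx ->]] := C1_01_mean_value (Cf n) x01 y01.
  rewrite mulrC -mulrBr normrM -mulrA ler_wpM2l//.
  apply: (le_trans (C1_01_lipschitz (Cf1 n) (fM2 n) x01 c01)).
  by rewrite mulrC ler_wpM2r// (le_trans (normr_ge0 _) (fM0 n x x01)).
rewrite lim_seriesZl// -mulrA mulrC ler_wpM2r//.
apply: le_trans (ltW ye); rewrite ler_wpM2l//.
by apply: (le_trans (ler_norm _)); rewrite lerDl.
Qed.

Lemma fun_series_uniform (f : nat -> R -> R) M eps : 0 < eps ->
  (forall n (x : R), x \in `[0, 1] -> `|f n x| <= M n) ->
  cvgn (series M) ->
  \forall N \near \oo, forall x : R, x \in `[0, 1] ->
    `|fun_series f x - \sum_(0 <= n < N) f n x| <= eps.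
Proof.
move=> eps0 fM cM.
have H : (limn (series M) - series M N) @[N --> \oo] --> 0.
  rewrite -[X in _ --> X](subrr (limn (series M))).
  by apply: cvgB => //; exact: cvg_cst.
move/cvgrPdist_le : H => /(_ eps eps0); apply: filterS => N HN x x01.
apply: le_trans (dominated_series_tail N (fun n => fM n x x01) cM) _.
by move: HN; rewrite sub0r normrN; apply: le_trans; exact: ler_norm.
Qed.

End SeriesOfFunctions.

(** * The Neumann eigensystem *)

Section Eigensystem.
Context {R : realType}.
Variables (V : R -> R) (mu : nat -> R) (e : nat -> R -> R) (C1 : R).
Hypothesis smoothV : smooth01 V.
Hypothesis Vpos : forall x : R, x \in `[0, 1] -> 0 < V x.
Hypothesis eigen : neumann_eigensystem V mu e.
Hypothesis C1_gt0 : 0 < C1.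
Hypothesis sobolev : sobolev_constant C1.

Let cV : cont01 V. Proof. exact: (@smooth01_cont _ _ 0 smoothV). Qed.

Lemma eigen_mu0 : 0 < mu 0%N. Proof. by case: eigen => -[]. Qed.

Lemma eigen_mu01 : mu 0%N < mu 1%N. Proof. by case: eigen => -[]. Qed.

Lemma eigen_mu_homo : {homo mu : m n / (m <= n)%N >-> m <= n}.
Proof. by apply: homo_leq => //; [exact: le_trans|case: eigen => -[]]. Qed.

Lemma eigen_mu_gt0 n : 0 < mu n.
Proof. exact: lt_le_trans eigen_mu0 (eigen_mu_homo (leq0n n)). Qed.

Lemma eigen_gap_gt0 n : n != 0%N -> 0 < mu n - mu 0%N.
Proof.
case: n => // n _; rewrite subr_gt0.
exact: lt_le_trans eigen_mu01 (eigen_mu_homo (ltn0Sn n)).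
Qed.

Lemma eigen_gap_ge0 n : 0 <= mu n - mu 0%N.
Proof. by rewrite subr_ge0; exact: eigen_mu_homo. Qed.

Lemma eigen_derivable n (x : R) : x \in `[0, 1] ->
  [/\ derivable01 (e n) x, derivable01 (D01 (e n)) x &
      - D01 (D01 (e n)) x + V x * e n x = mu n * e n x].
Proof. by case: eigen => _ /(_ n)[+ _ _] _ _ _; exact. Qed.

Lemma eigen_C1 n : C1_01 (e n) (D01 (e n)).
Proof.
apply: derivable01_C1; first by move=> x /(eigen_derivable n)[].
by apply: derivable01_cont => x /(eigen_derivable n)[].
Qed.

Lemma eigen_cont n : cont01 (e n). Proof. by case: (eigen_C1 n). Qed.

Lemma eigen_L2 n : L2_01 (e n). Proof. exact/cont01_L2/eigen_cont. Qed.

Lemma eigen_C2 n : C1_01 (D01 (e n)) (fun x => (V x - mu n) * e n x).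
Proof.
have E : {in `[0, 1], D01 (D01 (e n)) =1 (fun x => (V x - mu n) * e n x)}.
  move=> x /(eigen_derivable n)[_ _ H].
  by rewrite mulrBl -H opprD opprK addrCA subrr addr0.
apply: (eq_C1_01 E); apply: derivable01_C1.
  by move=> x /(eigen_derivable n)[].
apply: (@eq_cont01 _ (fun x => (V x - mu n) * e n x)); first by move=> x /E ->.
apply: cont01M; last exact: eigen_cont.
by apply: cont01B => //; exact: cont01_cst.
Qed.

Lemma eigen_D0 n : D01 (e n) 0 = 0.
Proof. by case: eigen => _ /(_ n)[]. Qed.

Lemma eigen_D1 n : D01 (e n) 1 = 0.
Proof. by case: eigen => _ /(_ n)[]. Qed.

Lemma eigen_dot i j : l2dot (e i) (e j) = (i == j)%:R.
Proof. by case: eigen. Qed.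

Lemma eigen_norm n : l2norm (e n) = 1.
Proof.
apply/eqP; rewrite -(@eqrXn2 _ 2)// ?l2norm_ge0// l2norm_sqr.
  by rewrite eigen_dot eqxx expr1n.
exact: eigen_L2.
Qed.

Lemma eigen0_gt0 (x : R) : x \in `[0, 1] -> 0 < e 0%N x.
Proof. by case: eigen => _ _ _ _; exact. Qed.

Section Combination.
Variables (a : nat -> R) (r : seq nat).
Hypothesis r_uniq : uniq r.

Let F x := \sum_(n <- r) a n * e n x.
Let F1 x := \sum_(n <- r) a n * D01 (e n) x.
Let F2 x := \sum_(n <- r) a n * ((V x - mu n) * e n x).

Let F_C1 : C1_01 F F1.
Proof. by apply: C1_01_sum => n; apply: C1_01Z; exact: eigen_C1. Qed.

Let F1_C1 : C1_01 F1 F2.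
Proof. by apply: C1_01_sum => n; apply: C1_01Z; exact: eigen_C2. Qed.

Let F_L2 : L2_01 F. Proof. by apply: cont01_L2; case: F_C1. Qed.

Lemma eigen_dot_comb n : n \in r -> l2dot (e n) F = a n.
Proof.
move=> nr; rewrite l2dot_sumr; [|exact: eigen_L2|]; last first.
  by move=> i; apply: L2_01Z; exact: eigen_L2.
rewrite (bigD1_seq n)//= l2dotZr; [|exact: eigen_L2..].
rewrite eigen_dot eqxx mulr1 big1 ?addr0// => i ni.
rewrite l2dotZr; [|exact: eigen_L2..].
by rewrite eigen_dot eq_sym (negbTE ni) mulr0.
Qed.

Lemma eigen_dot_comb_comb (b : nat -> R) :
  l2dot F (fun x => \sum_(n <- r) b n * e n x) = \sum_(n <- r) b n * a n.
Proof.
rewrite l2dot_sumr//; last by move=> i; apply: L2_01Z; exact: eigen_L2.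
rewrite !big_seq; apply: eq_bigr => n nr.
by rewrite l2dotZr//; [rewrite l2dotC eigen_dot_comb|exact: eigen_L2].
Qed.

(** Integration by parts, with Neumann conditions killing the boundary terms, gives equality up to
    the integral of [V F^2], which is dropped because V is positive. *)
Lemma eigen_comb_energy : l2dot F1 F1 <= \sum_(n <- r) mu n * a n ^+ 2.
Proof.
have := C1_01_ibp F_C1 F1_C1.
have -> : F1 0 = 0 by apply: big1 => n _; rewrite eigen_D0 mulr0.
have -> : F1 1 = 0 by apply: big1 => n _; rewrite eigen_D1 mulr0.
rewrite !mulr0 subrr sub0r => /esym/eqP; rewrite eqr_oppLR => /eqP ->.
have cF : cont01 F by case: F_C1.
have FVL : L2_01 (fun x => V x * F x) by apply: cont01_L2; exact: cont01M.
pose G x := \sum_(n <- r) (mu n * a n) * e n x.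
have GL : L2_01 G.
  apply: cont01_L2; apply: cont01_sum => n; apply: cont01M.
    exact: cont01_cst.
  exact: eigen_cont.
have -> : F2 = (fun x => V x * F x - G x).
  apply/funext => x; rewrite /F2 /F /G mulr_sumr -sumrB; apply: eq_bigr => n _.
  ring.
rewrite l2dotBr// opprB (eigen_dot_comb_comb (fun n => mu n * a n)).
rewrite (_ : \sum_(n <- r) mu n * a n * a n = \sum_(n <- r) mu n * a n ^+ 2).
  rewrite gerBl; apply: Rintegral_ge0 => x /= x01.
  by rewrite mulrCA mulr_ge0 ?sqr_ge0// ltW// Vpos.
by apply: eq_bigr => n _; rewrite -mulrA.
Qed.

(** Orthonormality gives the L^2 part of the H^1 norm and the energy bound the derivative part. All
    later sup estimates, including the one by [h1], come from this one. *)
Lemma eigen_comb_sup (x : R) : x \in `[0, 1] ->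
  `|F x| <= C1 * Num.sqrt (\sum_(n <- r) (1 + mu n) * a n ^+ 2).
Proof.
move=> x01; apply: (le_trans (sobolev_C1 sobolev F_C1 x01)).
rewrite ler_pM2l// ler_wsqrtr//.
under [leRHS]eq_bigr do rewrite mulrDl mul1r.
rewrite big_split lerD//; last exact: eigen_comb_energy.
by rewrite (eigen_dot_comb_comb a); apply: ler_sum => n _; rewrite -expr2.
Qed.

End Combination.

Lemma eigen_sup n (x : R) : x \in `[0, 1] -> `|e n x| <= C1 * (1 + mu n).
Proof.
move=> x01; have := @eigen_comb_sup (fun=> 1) [:: n] isT x x01.
rewrite !big_seq1 mul1r expr1n mulr1 => /le_trans; apply.
rewrite ler_pM2l// -[leRHS]ger0_norm; last first.
  by rewrite addr_ge0// ltW// eigen_mu_gt0.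
have m1 : 1 <= 1 + mu n by rewrite lerDl ltW// eigen_mu_gt0.
rewrite -sqrtr_sqr ler_wsqrtr// expr2 ler_peMl//.
exact: le_trans m1.
Qed.

(** Freeze [x] and take the combination with coefficients [e n x]: its value at that same [x] is the
    sum [K], so the sup bound reads [K <= C1 * sqrt ((1 + mu N) * K)], and one factor [K] cancels
    after squaring. *)
Lemma eigen_dot_sum_sqr N (x : R) : x \in `[0, 1] ->
  \sum_(0 <= n < N) e n x ^+ 2 <= C1 ^+ 2 * (1 + mu N).
Proof.
move=> x01; have := @eigen_comb_sup (fun n => e n x) _ (iota_uniq 0 N) x x01.
set K := \sum_(0 <= n < N) _.
have -> : \sum_(n <- iota 0 N) e n x * e n x = K.
  by rewrite /K /index_iota subn0; apply: eq_bigr.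
have K0 : 0 <= K by apply: sumr_ge0 => n _; exact: sqr_ge0.
have mN : 0 <= 1 + mu N by rewrite addr_ge0// ltW// eigen_mu_gt0.
move=> H; have {}H : K <= C1 * Num.sqrt ((1 + mu N) * K).
  apply: (le_trans (ler_norm _)); apply: (le_trans H).
  rewrite ler_pM2l// ler_wsqrtr// mulr_sumr /index_iota subn0 !big_seq.
  apply: ler_sum => n; rewrite mem_iota add0n => /andP[_ /ltnW nN].
  by rewrite ler_wpM2r ?sqr_ge0// lerD2l eigen_mu_homo.
have [->|Kn0] := eqVneq K 0; first by rewrite mulr_ge0// sqr_ge0.
have Kgt0 : 0 < K by rewrite lt_def Kn0.
have : K ^+ 2 <= C1 ^+ 2 * ((1 + mu N) * K).
  rewrite -[X in C1 ^+ 2 * X]sqr_sqrtr ?mulr_ge0// -exprMn.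
  by rewrite ler_pXn2r ?nnegrE// mulr_ge0 ?sqrtr_ge0// ltW.
by rewrite mulrA expr2 ler_pM2r.
Qed.

(* Only linear growth is needed, and the Sobolev constant alone provides it:
   integrate the bound on sum_n e_n(x)^2. *)
Lemma eigen_growth N : N%:R <= C1 ^+ 2 * (1 + mu N).
Proof.
have cK : cont01 (fun x => \sum_(0 <= n < N) e n x ^+ 2).
  by apply: cont01_sum => n; apply: cont01M; exact: eigen_cont.
have : \int[leb]_(x in `[0, 1]) (\sum_(0 <= n < N) e n x ^+ 2) <=
    \int[leb]_(x in `[0%R, 1%R]) (C1 ^+ 2 * (1 + mu N)).
  apply: le_Rintegral => //; first exact: cont01_integrable.
    by apply: cont01_integrable; exact: cont01_cst.
  by move=> x x01; exact: eigen_dot_sum_sqr.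
rewrite Rintegral_cst//= lebesgue_measure_itv/= lte_fin ltr01 sube0 mulr1.
apply: le_trans.
have c1 : L2_01 (fun=> 1 : R) by exact/cont01_L2/cont01_cst.
have := @l2dot_sumr _ _ (index_iota 0 N) (fun=> 1) (fun n x => e n x ^+ 2) c1.
have -> : l2dot (fun=> 1) (fun x => \sum_(0 <= n < N) e n x ^+ 2) =
    \int[leb]_(x in `[0, 1]) (\sum_(0 <= n < N) e n x ^+ 2).
  by apply: eq_Rintegral => x _; rewrite mul1r.
move=> ->; last by move=> n; apply: cont01_L2; apply: cont01M;
  exact: eigen_cont.
rewrite (eq_bigr (fun=> 1)); first by rewrite sumr_const_nat subn0.
move=> n _; transitivity (l2dot (e n) (e n)); last by rewrite eigen_dot eqxx.
by apply: eq_Rintegral => x _; rewrite mul1r.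
Qed.

(** Half of the exponential absorbs the power of [1 + mu n]; the other half is at most a geometric
    sequence by the linear growth of the eigenvalues. *)
Lemma eigen_weight_series (k : nat) (t : R) : 0 < t ->
  cvgn (series (fun n => (1 + mu n) ^+ k * expR (- (mu n - mu 0%N) * t))).
Proof.
(* From [s * y <= expR (s * y)] raised to the power [k], the exponent is [k * s * y <= y * t / 2].
   Dividing by [k.+1] rather than [k] covers [k = 0]. *)
move=> t0; pose s := t / (2 * (k.+1)%:R).
have k1 : 0 < k.+1%:R :> R by rewrite ltr0n.
have s0 : 0 < s by rewrite divr_gt0// mulr_gt0.
pose q := expR (- t / (2 * C1 ^+ 2)).
pose K := s ^- k * expR ((1 + mu 0%N) * t).
have C20 : 0 < C1 ^+ 2 by rewrite exprn_gt0.
have q0 : 0 < q by exact: expR_gt0.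
have q1 : `|q| < 1.
  by rewrite gtr0_norm// /q expR_lt1 mulNr oppr_lt0 divr_gt0// mulr_gt0.
apply: (@dominated_series_cvg _ _ (geometric K q)); last first.
  exact: is_cvg_geometric_series.
move=> n; have m0 : 0 < 1 + mu n by rewrite addr_gt0// eigen_mu_gt0.
rewrite ger0_norm; last by rewrite mulr_ge0 ?expR_ge0// exprn_ge0// ltW.
rewrite /geometric /=.
have h1 : (1 + mu n) ^+ k <= s ^- k * expR ((1 + mu n) * (t / 2)).
  apply: (@le_trans _ _ (s ^- k * expR (s * (1 + mu n)) ^+ k)).
    rewrite -exprVn -exprMn; apply: lerXn2r; rewrite ?nnegrE.
    - exact: ltW.
    - by rewrite mulr_ge0 ?expR_ge0// invr_ge0 ltW.
    rewrite mulrC ler_pdivlMr// mulrC.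
    by apply: le_trans (expR_ge1Dx _); rewrite lerDr.
  rewrite ler_wpM2l ?invr_ge0 ?exprn_ge0 ?(ltW s0)// -expRM_natl ler_expR.
  rewrite mulrA mulrC ler_wpM2l ?(ltW m0)// /s.
  have -> : k%:R * (t / (2 * k.+1%:R)) = (t / 2) * (k%:R / k.+1%:R).
    by rewrite invfM; ring.
  rewrite ler_piMr ?divr_ge0 ?(ltW t0)//.
  by rewrite ler_pdivrMr// mul1r ler_nat.
have h2 : expR ((1 + mu n) * (t / 2)) * expR (- (mu n - mu 0%N) * t) =
    expR ((1 + mu 0%N) * t) * expR (- ((1 + mu n) * (t / 2))).
  by rewrite -!expRD; congr expR; field.
have h3 : expR (- ((1 + mu n) * (t / 2))) <= q ^+ n.
  rewrite -expRM_natl ler_expR mulNr mulrN lerN2.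
  have -> : n%:R * (t / (2 * C1 ^+ 2)) = n%:R / C1 ^+ 2 * (t / 2).
    by rewrite invfM; ring.
  rewrite ler_wpM2r ?divr_ge0 ?(ltW t0)//.
  by rewrite ler_pdivrMr// mulrC; exact: eigen_growth.
apply: (le_trans (ler_wpM2r (expR_ge0 _) h1)).
rewrite -mulrA h2 /K -[leRHS]mulrA ler_wpM2l ?invr_ge0 ?exprn_ge0 ?(ltW s0)//.
by rewrite ler_wpM2l ?expR_ge0.
Qed.

End Eigensystem.

(** * Eigenfunction series with exponentially damped coefficients *)

Section Expansion.
Context {R : realType}.
Variables (V : R -> R) (mu : nat -> R) (e : nat -> R -> R) (C1 : R).
Hypothesis smoothV : smooth01 V.
Hypothesis Vpos : forall x : R, x \in `[0, 1] -> 0 < V x.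
Hypothesis eigen : neumann_eigensystem V mu e.
Hypothesis C1_gt0 : 0 < C1.
Hypothesis sobolev : sobolev_constant C1.

(** The second derivative is read off the eigenvalue equation. The first one vanishes at 0, so it is
    bounded by the sup of the second. *)
Lemma eigen_C2_bound : exists2 K, 0 < K & forall n (x : R), x \in `[0, 1] ->
  [/\ `|e n x| <= K * (1 + mu n) ^+ 2, `|D01 (e n) x| <= K * (1 + mu n) ^+ 2 &
      `|(V x - mu n) * e n x| <= K * (1 + mu n) ^+ 2].
Proof.
have [M M0 VM] := cont01_bounded (@smooth01_cont _ _ 0 smoothV).
have K0 : 0 < C1 * (M + 1) by rewrite mulr_gt0// addr_gt0.
exists (C1 * (M + 1)) => // n x x01.
have mn := eigen_mu_gt0 eigen n.
have m1 : 1 <= 1 + mu n by rewrite lerDl ltW.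
have m0 : 0 <= 1 + mu n by exact: le_trans m1.
have B2 y : y \in `[0, 1] ->
    `|(V y - mu n) * e n y| <= C1 * (M + 1) * (1 + mu n) ^+ 2.
  move=> y01; rewrite normrM.
  have -> : C1 * (M + 1) * (1 + mu n) ^+ 2 =
      (M + 1) * (1 + mu n) * (C1 * (1 + mu n)) by ring.
  apply: ler_pM => //;
    last exact: (eigen_sup smoothV Vpos eigen C1_gt0 sobolev).
  apply: (le_trans (ler_normB _ _)); rewrite (gtr0_norm mn).
  apply: (@le_trans _ _ (M + mu n)); first by rewrite lerD2r; exact: VM.
  by have := mulr_ge0 (ltW M0) (ltW mn); rewrite mulrDl mul1r mulrDr mulr1; lra.
split; last exact: B2.
  apply: (le_trans (eigen_sup smoothV Vpos eigen C1_gt0 sobolev n x01)).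
  rewrite -mulrA ler_pM2l// -[leLHS]mul1r expr2 mulrA ler_wpM2r//.
  by rewrite mulr_ege1// lerDr ltW.
have := C1_01_lipschitz (eigen_C2 smoothV eigen n) B2 zero_in01 x01.
rewrite (eigen_D0 eigen) !subr0 => /le_trans; apply.
apply: ler_piMr; first by rewrite mulr_ge0 ?exprn_ge0// ltW.
by move: x01; rewrite in_itv /= => /andP[x0 x1]; rewrite ger0_norm.
Qed.

Section Coefficients.
Variables (rho : nat -> R) (B t : R).
Hypothesis rhoB : forall n, `|rho n| <= B.
Hypothesis t0 : 0 < t.

(** Coefficients of the heat semigroup of A, renormalised by [expR (mu 0 * t)] so that the ground
    mode stays fixed. *)
Definition heat_coef n := expR (- (mu n - mu 0%N) * t) * rho n.

Definition heat_sum := fun_series (fun n x => heat_coef n * e n x).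

Definition heat_sum1 := fun_series (fun n x => heat_coef n * D01 (e n) x).

Lemma heat_coef_bound : exists2 M : nat -> R, cvgn (series M) &
  forall n (x : R), x \in `[0, 1] ->
  [/\ `|heat_coef n * e n x| <= M n, `|heat_coef n * D01 (e n) x| <= M n &
      `|heat_coef n * ((V x - mu n) * e n x)| <= M n].
Proof.
have [K K0 eK] := eigen_C2_bound.
exists (fun n => (B * K) * ((1 + mu n) ^+ 2 * expR (- (mu n - mu 0%N) * t))).
  apply: cvgn_seriesZ.
  exact: (eigen_weight_series smoothV Vpos eigen C1_gt0 sobolev).
move=> n x /(eK n).
have W y : `|y| <= K * (1 + mu n) ^+ 2 -> `|heat_coef n * y| <=
    B * K * ((1 + mu n) ^+ 2 * expR (- (mu n - mu 0%N) * t)).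
  move=> yK; rewrite /heat_coef !normrM gtr0_norm ?expR_gt0//.
  have -> : B * K * ((1 + mu n) ^+ 2 * expR (- (mu n - mu 0%N) * t)) =
    expR (- (mu n - mu 0%N) * t) * B * (K * (1 + mu n) ^+ 2) by ring.
  apply: ler_pM => //.
  by apply: ler_wpM2l => //; exact: expR_ge0.
by case=> /W ? /W ? /W ?.
Qed.

Lemma heat_sum_C1 : C1_01 heat_sum heat_sum1.
Proof.
have [M cM HM] := heat_coef_bound.
apply: (fun_series_C1 _ _ HM cM) => n; apply: C1_01Z.
  exact: (eigen_C1 eigen).
exact: (eigen_C2 smoothV eigen).
Qed.

Lemma heat_sum_abs_cvg (x : R) : x \in `[0, 1] ->
  cvgn (series (fun n => `|heat_coef n * e n x|)).
Proof.
have [M cM HM] := heat_coef_bound => x01.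
by apply: dominated_series_norm_cvg cM => n; have [] := HM n x x01.
Qed.

Lemma heat_sum_cvg (x : R) : x \in `[0, 1] ->
  series (fun n => heat_coef n * e n x) @ \oo --> heat_sum x.
Proof.
have [M cM HM] := heat_coef_bound => x01.
apply: (@dominated_series_cvg _ _ M) => // n.
by have [] := HM n x x01.
Qed.

Lemma heat_sum1_cvg (x : R) : x \in `[0, 1] ->
  series (fun n => heat_coef n * D01 (e n) x) @ \oo --> heat_sum1 x.
Proof.
have [M cM HM] := heat_coef_bound => x01.
apply: (@dominated_series_cvg _ _ M) => // n.
by have [] := HM n x x01.
Qed.

Lemma heat_sum_dot q : l2dot (e q) heat_sum = heat_coef q.
Proof.
have [M cM HM] := heat_coef_bound.
have [cF _ _] := heat_sum_C1.
apply/eqP; rewrite -subr_eq0 -normr_le0; apply/ler_addgt0Pr => eps eps0.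
rewrite add0r.
have HM0 n x x01 := let: And3 h _ _ := HM n x x01 in h.
have [N _ HN] := fun_series_uniform eps0 HM0 cM.
(* The truncation lies beyond [q], so the partial sum already has [heat_coef q] as its exact [q]-th
   coefficient, and only the uniformly small remainder is estimated. *)
pose N' := maxn N q.+1; have {}HN := HN N' (leq_maxl _ _).
pose S x := \sum_(0 <= n < N') heat_coef n * e n x.
have cS : cont01 S.
  apply: cont01_sum => n; apply: cont01M; first exact: cont01_cst.
  exact: (eigen_cont eigen).
have -> : heat_coef q = l2dot (e q) S.
  rewrite (eigen_dot_comb eigen)// ?iota_uniq// mem_iota subn0 add0n /=.
  by rewrite /N' leq_max leqnn orbT.
have eqL := eigen_L2 eigen q.
rewrite -l2dotBr//; [|exact: cont01_L2..].
apply: (le_trans (l2dot_CS eqL (cont01_L2 (cont01B cF cS)))).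
rewrite (eigen_norm eigen) mul1r; apply: l2norm_le_sup => //; last exact: ltW.
exact: cont01B.
Qed.

(** The difference has zero coefficients, so completeness makes it vanish almost everywhere;
    continuity then gives every interior point. *)
Lemma heat_sum_unique w : cont01 w ->
  (forall n, l2dot (e n) w = heat_coef n) -> {in `]0, 1[, w =1 heat_sum}.
Proof.
move=> cw Hw; have [cF _ _] := heat_sum_C1.
apply: cont01_eq_oo => //.
have wFL : L2_01 (fun x => w x - heat_sum x) by exact/cont01_L2/cont01B.
have : forall n, l2dot (e n) (fun x => w x - heat_sum x) = 0.
  move=> n; rewrite l2dotBr ?heat_sum_dot ?Hw ?subrr//.
  - exact: (eigen_L2 eigen).
  - exact: cont01_L2.
  - exact: cont01_L2.
case: eigen => _ _ _ /(_ _ wFL) H _ /H.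
apply: filterS; first exact: (ae_filter_ringOfSetsType leb).
by move=> x Hx /Hx /eqP; rewrite subr_eq0 => /eqP.
Qed.

Lemma heat_sum1_0 : heat_sum1 0 = 0.
Proof.
apply/cvg_lim => //; rewrite (_ : series _ = fun=> 0); first exact: cvg_cst.
apply/funext => N; rewrite /series /= big1// => n _.
by rewrite (eigen_D0 eigen) mulr0.
Qed.

Lemma heat_sum1_1 : heat_sum1 1 = 0.
Proof.
apply/cvg_lim => //; rewrite (_ : series _ = fun=> 0); first exact: cvg_cst.
apply/funext => N; rewrite /series /= big1// => n _.
by rewrite (eigen_D1 eigen) mulr0.
Qed.

End Coefficients.
End Expansion.

(** * The smoothing rate h1 *)

Section SmoothingRate.
Context {R : realType}.
Variables (V : R -> R) (mu : nat -> R) (e : nat -> R -> R) (C1 : R).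
Hypothesis smoothV : smooth01 V.
Hypothesis Vpos : forall x : R, x \in `[0, 1] -> 0 < V x.
Hypothesis eigen : neumann_eigensystem V mu e.
Hypothesis C1_gt0 : 0 < C1.
Hypothesis sobolev : sobolev_constant C1.

Let w (t : R) n := (1 + mu n) * expR (- 2 * (mu n - mu 0%N) * t).

(** The sum in [h1] starts at 1; a zero in position 0 turns it into a plain [series]. *)
Let wt (t : R) n := if n == 0%N then 0 else w t n.

Let wtE t : (fun N : nat => \sum_(1 <= n < N) w t n) = series (wt t).
Proof.
apply/funext => -[|N]; first by rewrite /series /= !big_geq.
rewrite /series /= [RHS]big_ltn// {1}/wt eqxx add0r.
by rewrite big_nat_cond [RHS]big_nat_cond; apply: eq_bigr => -[].
Qed.

Definition h1_sum (t : R) : R := limn (series (wt t)).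

Lemma h1E t : h1 mu C1 t = C1 * Num.sqrt (h1_sum t).
Proof. by rewrite /h1 /h1_sum -wtE. Qed.

Let mu1 n : 0 < 1 + mu n.
Proof. by rewrite addr_gt0// (eigen_mu_gt0 eigen). Qed.

Let w_gt0 t n : 0 < w t n.
Proof. by rewrite mulr_gt0 ?expR_gt0. Qed.

Let wt_ge0 t n : 0 <= wt t n.
Proof. by rewrite /wt; case: eqP => // _; exact/ltW/w_gt0. Qed.

Let wt_cvg t : 0 < t -> cvgn (series (wt t)).
Proof.
move=> t0; have t20 : 0 < 2 * t by rewrite mulr_gt0.
have := eigen_weight_series smoothV Vpos eigen C1_gt0 sobolev (k := 1) t20.
apply: dominated_series_cvg => n; rewrite ger0_norm//.
have -> : - (mu n - mu 0%N) * (2 * t) = - 2 * (mu n - mu 0%N) * t by ring.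
rewrite expr1 -/(w t n) /wt; case: eqP => // _; exact/ltW/w_gt0.
Qed.

Let partial_le t N : 0 < t -> \sum_(1 <= n < N) w t n <= h1_sum t.
Proof.
move=> t0; rewrite -[leLHS]/((fun N : nat => \sum_(1 <= n < N) w t n) N) wtE.
apply: nondecreasing_cvgn_le; last exact: wt_cvg.
by apply: nondecreasing_series => n _ _.
Qed.

Lemma h1_sum_gt0 t : 0 < t -> 0 < h1_sum t.
Proof. by move=> t0; apply: lt_le_trans (partial_le 2 t0);
  rewrite big_nat1. Qed.

Lemma h1_gt0 t : 0 < t -> 0 < h1 mu C1 t.
Proof. by move=> t0; rewrite h1E mulr_gt0// sqrtr_gt0 h1_sum_gt0. Qed.

Let wt_le s t n : s <= t -> wt t n <= wt s n.
Proof.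
move=> st; rewrite /wt; case: eqP => // /eqP n0.
rewrite ler_pM2l// ler_expR !mulNr lerN2 ler_wpM2l//.
by rewrite mulr_ge0 ?(eigen_gap_ge0 eigen).
Qed.

(** All differences of terms are nonnegative, and the term of index 1 alone already gives
    strictness, since [mu 1] exceeds [mu 0]. *)
Lemma h1_sum_decr s t : 0 < s -> s < t -> h1_sum t < h1_sum s.
Proof.
move=> s0 st; have t0 := lt_trans s0 st.
have cs := wt_cvg s0; have ct := wt_cvg t0.
rewrite -subr_gt0 -lim_seriesB//.
apply: (@lt_le_trans _ _ (w s 1 - w t 1)).
  rewrite subr_gt0 ltr_pM2l// ltr_expR !mulNr ltrN2 ltr_pM2l//.
  by rewrite mulr_gt0// (eigen_gap_gt0 eigen).
have -> : w s 1 - w t 1 = series (wt s - wt t) 2.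
  by rewrite /series /= big_nat_recr//= big_nat1 !fctE /wt /= subrr add0r.
apply: (@nondecreasing_cvgn_le _ (series (wt s - wt t))); last first.
  exact: is_cvg_seriesB cs ct.
by apply: nondecreasing_series => n _ _; rewrite !fctE subr_ge0 wt_le// ltW.
Qed.

Lemma h1_decr s t : 0 < s -> s < t -> h1 mu C1 t < h1 mu C1 s.
Proof.
move=> s0 st; rewrite !h1E ltr_pM2l// ltr_sqrt ?h1_sum_gt0//.
exact: h1_sum_decr.
Qed.

Lemma h1_sum_continuous a b : 0 < a -> {within `[a, b], continuous h1_sum}.
Proof.
move=> a0.
(* [L n] is a Lipschitz constant of the [n]-th term on [[a, +oo[]: by [1 - expR (- y) <= y], the
   increment is controlled by the slope [2 * (mu n - mu 0)], here enlarged to [2 * (1 + mu n)]. *)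
pose L n := 2 * ((1 + mu n) ^+ 2 * expR (- (mu n - mu 0%N) * (2 * a))).
have a20 : 0 < 2 * a by rewrite mulr_gt0.
have cL : cvgn (series L).
  apply: cvgn_seriesZ.
  exact: (eigen_weight_series smoothV Vpos eigen C1_gt0 sobolev).
apply: (@lipschitz_within _ _ _ _ (limn (series L))).
suff H x y : a <= x -> x <= y ->
    `|h1_sum y - h1_sum x| <= limn (series L) * `|y - x|.
  move=> x y; rewrite !in_itv /= => /andP[ax _] /andP[ay _].
  have [xy|/ltW yx] := leP x y; first exact: H.
  by rewrite distrC [`|y - x|]distrC; exact: H.
move=> ax xy; have ay := le_trans ax xy.
rewrite -lim_seriesB; try by apply: wt_cvg; exact: lt_le_trans a0 _.
rewrite mulrC -(lim_seriesZl _ cL); apply: dominated_series_le; last first.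
  exact: cvgn_seriesZ.
move=> n; rewrite !fctE distrC ger0_norm ?subr_ge0 ?wt_le//.
rewrite (@ger0_norm _ (y - x)) ?subr_ge0//.
have g0 := eigen_gap_ge0 eigen n.
have yx0 : 0 <= y - x by rewrite subr_ge0.
have mn := ltW (mu1 n).
rewrite /wt; case: eqP => [_|_].
  by rewrite subr0 !mulr_ge0 ?exprn_ge0 ?expR_ge0.
rewrite /w /L -mulrBr.
have -> : (y - x) * (2 * ((1 + mu n) ^+ 2 * expR (- (mu n - mu 0%N) * (2 * a))))
  = (1 + mu n) * (expR (- (mu n - mu 0%N) * (2 * a)) *
      (2 * (1 + mu n) * (y - x))) by ring.
rewrite ler_wpM2l//.
have -> : - 2 * (mu n - mu 0%N) * y =
   - 2 * (mu n - mu 0%N) * x + - (2 * (mu n - mu 0%N) * (y - x)) by ring.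
rewrite expRD -{1}[expR _]mulr1 -mulrBr; apply: ler_pM.
- exact: expR_ge0.
- rewrite subr_ge0 -[leRHS]expR0 ler_expR oppr_le0.
  by rewrite mulr_ge0// mulr_ge0.
- rewrite ler_expR.
  have -> : - 2 * (mu n - mu 0%N) * x = - (mu n - mu 0%N) * (2 * x) by ring.
  by rewrite !mulNr lerN2 ler_wpM2l// ler_pM2l.
- have := expR_ge1Dx (- (2 * (mu n - mu 0%N) * (y - x))) => H.
  apply: (@le_trans _ _ (2 * (mu n - mu 0%N) * (y - x))).
    by rewrite lerBlDr -lerBlDl.
  rewrite ler_wpM2r// ler_pM2l//.
  by rewrite lerBlDr -addrA addrCA lerDl addr_ge0// ltW// (eigen_mu_gt0 eigen).
Qed.

Lemma h1_sum_surj Y : 0 < Y -> exists2 t, 0 < t & h1_sum t = Y.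
Proof.
move=> Y0.
have [N HN] : exists N : nat, 2 * Y <= N%:R.
  by exists (Num.truncn (2 * Y)).+1; exact/ltW/truncnS_gt.
pose g := mu N.+1 - mu 0%N.
have g0 : 0 < g by rewrite (eigen_gap_gt0 eigen).
(* For indices 1 to [N] the exponent at time [a] is at least -1/2, so each of these terms is at
   least 1/2 by [expR y >= 1 + y], and their sum reaches [N / 2 >= Y]. *)
pose a := (4 * g)^-1.
have a0 : 0 < a by rewrite invr_gt0 mulr_gt0.
have Ya : Y <= h1_sum a.
  apply: le_trans (partial_le N.+1 a0).
  apply: (@le_trans _ _ (\sum_(1 <= n < N.+1) 2^-1)).
    by rewrite sumr_const_nat subn1 /= -(mulr_natl _ N) ler_pdivlMr// mulrC.
  rewrite big_nat_cond [leRHS]big_nat_cond; apply: ler_sum =>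
    n /andP[/andP[n1 nN] _].
  rewrite -[leLHS]mul1r; apply: ler_pM => //.
    by rewrite lerDl ltW// (eigen_mu_gt0 eigen).
  apply: (le_trans _ (expR_ge1Dx _)).
  have ng : mu n - mu 0%N <= g.
    by rewrite lerD2r; apply: (eigen_mu_homo eigen); exact: ltnW.
  have : (mu n - mu 0%N) * a <= 4^-1.
    apply: (@le_trans _ _ (g * a)); first by rewrite ler_wpM2r// ltW.
    by rewrite /a invfM mulrCA divff ?mulr1// gt_eqF.
  by rewrite -mulrA mulNr; lra.
pose g1 := mu 1%N - mu 0%N.
have g10 : 0 < g1 by rewrite (eigen_gap_gt0 eigen).
pose S := h1_sum 1; have S0 : 0 < S by exact: h1_sum_gt0.
(* Every gap is at least [g1], so waiting [b - 1] beyond time 1 multiplies the sum by at most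
   [expR (- (S / Y))]; and [S * expR (- (S / Y)) <= Y] because [expR y >= 1 + y]. *)
pose b := 1 + S / (2 * g1 * Y).
have b1 : 1 <= b by rewrite lerDl !(mulr_ge0, invr_ge0)// ltW.
have b0 : 0 < b by exact: lt_le_trans b1.
have bY : h1_sum b <= Y.
  apply: (@le_trans _ _ (expR (- (S / Y)) * S)).
    rewrite -[S in _ * S]/(limn (series (wt 1))) -(lim_seriesZl _ (wt_cvg
      ltr01)).
    rewrite /h1_sum; apply: ler_lim.
    - exact: wt_cvg.
    - exact/cvgn_seriesZ/wt_cvg.
    apply: nearW => m; rewrite /series /=; apply: ler_sum => n _.
    rewrite /wt; case: eqP => [_|/eqP n0]; first by rewrite mulr0.
    rewrite /w mulrCA ler_pM2l// -expRD ler_expR mulr1.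
    have -> : - 2 * (mu n - mu 0%N) * b =
       - 2 * (mu n - mu 0%N) + - (2 * (mu n - mu 0%N) * (S / (2 * g1 * Y))).
      by rewrite /b; ring.
    rewrite addrC lerD2r lerN2.
    have -> : S / Y = 2 * g1 * (S / (2 * g1 * Y)).
      by field; rewrite !gt_eqF.
    rewrite ler_wpM2r//; first by rewrite !(mulr_ge0, invr_ge0)// ltW.
    rewrite ler_pM2l// lerD2r; apply: (eigen_mu_homo eigen).
    by rewrite lt0n.

  rewrite expRN mulrC ler_pdivrMr ?expR_gt0//.
  apply: (@le_trans _ _ (Y * (1 + S / Y))).
    by rewrite mulrDr mulr1 mulrC divfK ?gt_eqF// lerDr ltW.
  by rewrite ler_pM2l// expR_ge1Dx.
have ab : a <= b.
  rewrite leNgt; apply/negP => ba.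
  by have := h1_sum_decr b0 ba; rewrite ltNge (le_trans bY Ya).
have [|t] := @IVT _ h1_sum a b Y ab (h1_sum_continuous (b := b) a0).
  by rewrite ge_min bY orbT le_max Ya.
rewrite in_itv /= => /andP[at_ _] <-; exists t => //.
exact: lt_le_trans a0 at_.
Qed.

(** [h1_inv] is a partial inverse with default value 0. Surjectivity of [h1_sum], at the value
    [(y / C1) ^+ 2], supplies a preimage, and strict monotonicity makes it the one that is
    returned. *)
Lemma h1_inv_spec y : 0 < y ->
  0 < h1_inv mu C1 y /\ h1 mu C1 (h1_inv mu C1 y) = y.
Proof.
move=> y0; have Y0 : 0 < (y / C1) ^+ 2 by rewrite exprn_gt0// divr_gt0.
have [t t0 Et] := h1_sum_surj Y0.
have h1t : h1 mu C1 t = y.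
  rewrite h1E Et sqrtr_sqr ger0_norm ?divr_ge0 ?(ltW y0) ?(ltW C1_gt0)//.
  by rewrite mulrC divfK// gt_eqF.
suff -> : h1_inv mu C1 y = t by [].
rewrite -h1t /h1_inv pinvKV//; last by rewrite inE /= in_itv /= t0.
move=> a b; rewrite !inE /= !in_itv /= !andbT => a0 b0 hab.
have [ab|ba|//] := ltgtP a b.
- by have := h1_decr a0 ab; rewrite hab ltxx.
- by have := h1_decr b0 ba; rewrite hab ltxx.
Qed.

(** This is the estimate for which [h1] is designed: the squared coefficients carry twice the
    exponent, and [B ^+ 2] factors out of the weighted sum. *)
Lemma heat_tail_sup (rho : nat -> R) (B t x : R) N : 0 < t -> 0 <= B ->
  (forall n, n != 0%N -> `|rho n| <= B) -> x \in `[0, 1] ->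
  `|\sum_(1 <= n < N) heat_coef mu rho t n * e n x| <= B * h1 mu C1 t.
Proof.
move=> t0 B0 rhoB x01.
have := @eigen_comb_sup _ _ _ _ _ smoothV Vpos eigen C1_gt0 sobolev
  (heat_coef mu rho t) (index_iota 1 N) (iota_uniq _ _) x x01.
move=> /le_trans; apply; rewrite h1E mulrCA ler_pM2l//.
rewrite -[X in X * _](ger0_norm B0) -sqrtr_sqr -sqrtrM ?sqr_ge0// ler_wsqrtr//.
apply: (le_trans _ (ler_wpM2l (sqr_ge0 B) (partial_le N t0))).
rewrite mulr_sumr !big_seq; apply: ler_sum => n.
rewrite mem_index_iota => /andP[n0 _].
rewrite /w [leRHS]mulrCA ler_pM2l// /heat_coef exprMn -expRM_natl mulrC.
have -> : 2%:R * (- (mu n - mu 0%N) * t) = - 2 * (mu n - mu 0%N) * t by ring.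
rewrite ler_wpM2r ?expR_ge0// -real_normK ?num_real//.
by rewrite ler_pXn2r ?nnegrE// rhoB// -lt0n.
Qed.

End SmoothingRate.

(** * Unordered sums over tuples *)

Section TupleSums.
Context {R : realType}.
Import finmap summability.

Lemma partial_sum_seqE (I : choiceType) (x : I -> R) (A : {fset I}) :
  partial_sum x A = \sum_(i <- A) x i.
Proof. by rewrite /partial_sum [RHS]big_seq_fsetE. Qed.

Lemma partial_sum_diff (I : choiceType) (x : I -> R) (A B : {fset I}) :
  fsubset A B ->
  partial_sum x B - partial_sum x A = \sum_(i <- B | i \notin A) x i.
Proof.
move=> AB; rewrite !partial_sum_seqE (bigID (mem A)) /= -big_filter.
rewrite [X in X + _ - _](_ : _ = \sum_(i <- A) x i);
  first by rewrite addrC addKr.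
apply: perm_big; apply: uniq_perm;
  [exact/filter_uniq/fset_uniq|exact: fset_uniq|].
move=> i; rewrite mem_filter; case iA : (i \in A) => //=.
exact: (fsubsetP AB).
Qed.

Local Notation index := {n : nat | n != 0%N}.

Section Box.
Variables m M : nat.

(** Finite functions are used because the expansion of a product of sums is indexed by them; the
    successor maps ['I_M] onto the entries 1 to [M], all nonzero. *)
Definition box_tuple (f : {ffun 'I_m -> 'I_M}) : m.-tuple index :=
  [tuple (exist (fun n => n != 0%N) (f i).+1 isT : index) | i < m].

Lemma box_tuple_inj : injective box_tuple.
Proof.
move=> f g fg; apply/ffunP => i; apply/val_inj.
have := congr1 (fun t => val (tnth t i)) fg.
by rewrite /box_tuple !tnth_mktuple /= => -[].
Qed.

Definition box : {fset m.-tuple index} :=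
  seq_fset tt (map box_tuple (enum {: {ffun 'I_m -> 'I_M}})).

Lemma box_sum (a : nat -> R) :
  partial_sum (fun q : m.-tuple index => \prod_(i <- map val q) a i) box =
  (\sum_(0 <= n < M) a n.+1) ^+ m.
Proof.
rewrite partial_sum_seqE.
rewrite (perm_big (map box_tuple (enum {: {ffun 'I_m -> 'I_M}}))); last first.
  apply: uniq_perm; first exact: fset_uniq.
    by rewrite map_inj_uniq ?enum_uniq//; exact: box_tuple_inj.
  by move=> q; rewrite seq_fsetE.
rewrite big_map big_enum /= big_mkord.
transitivity (\prod_(i < m) \sum_(j < M) a j.+1); last first.
  by rewrite prodr_const card_ord.
rewrite bigA_distr_bigA; apply: eq_bigr => f _.
by rewrite !big_map.
Qed.

Lemma mem_box (q : m.-tuple index) :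
  (forall i, (val (tnth q i) <= M)%N) -> q \in box.
Proof.
move=> qM; rewrite seq_fsetE.
have H i : ((val (tnth q i)).-1 < M)%N.
  by have := valP (tnth q i); have := qM i; case: (val _).
apply/mapP; exists [ffun i => Ordinal (H i)]; first by rewrite mem_enum.
apply: eq_from_tnth => i; rewrite tnth_mktuple ffunE; apply/val_inj => /=.
by rewrite prednK// lt0n; exact: valP (tnth q i).
Qed.

End Box.

Lemma box_exhaust m (A : {fset m.-tuple index}) :
  \forall M \near \oo, fsubset A (box m M).
Proof.
exists (\max_(q <- A) \max_(i < m) val (tnth q i)) => // M /= AM.
apply/fsubsetP => q qA; apply: mem_box => i; apply: leq_trans AM.
apply: leq_trans (leq_bigmax_seq _ qA isT).
exact: (leq_bigmax i).
Qed.

(** Over the box of tuples with entries at most [M], distributivity gives the [m]-th power of a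
    partial sum. The boxes exhaust the index set, and absolute convergence makes everything outside
    a large box negligible. *)
Lemma unordered_tuple_sum (a : nat -> R) m :
  cvgn (series (fun n => `|a n.+1|)) ->
  partial_sum (fun q : m.-tuple index => \prod_(i <- map val q) a i)
    @ totally --> limn (series (fun n => a n.+1)) ^+ m.
Proof.
move=> ca; have cb : cvgn (series (fun n => a n.+1)) by exact: normed_cvg.
set s := fun M => \sum_(0 <= n < M) a n.+1.
pose sa M := \sum_(0 <= n < M) `|a n.+1|.
have cs : s M ^+ m @[M --> \oo] --> limn (series (fun n => a n.+1)) ^+ m.
  by apply: (@cvg_comp _ _ _ s (fun z => z ^+ m));
    [exact: cb|exact: exprn_continuous].
have csa : sa M ^+ m @[M --> \oo] --> limn (series (fun n => `|a n.+1|)) ^+ m.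
  by apply: (@cvg_comp _ _ _ sa (fun z => z ^+ m));
    [exact: ca|exact: exprn_continuous].
have FF := @totally_filter (m.-tuple index).
apply/cvgrPdist_le => eps eps0.
(* Any finite [A] containing this box works: for a box of size [M] covering [A], the terms between
   [A] and that box are bounded in absolute value by those between the two boxes. *)
move/cvgrPdist_le : (csa) => /(_ eps eps0)[N _ /(_ N (leqnn N)) HN].
exists (box m N) => // A /= NA.
set S := partial_sum _.
set Sa := partial_sum (fun q : m.-tuple index => `|\prod_(i <- map val q) a i|).
have SaE : Sa = partial_sum (fun q : m.-tuple index =>
  \prod_(i <- map val q) `|a i|).
  by congr partial_sum; apply/funext => q; rewrite normr_prod.
have H1 : (`|S (box m M) - S A|) @[M --> \oo] -->
    `|limn (series (fun n => a n.+1)) ^+ m - S A|.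
  apply: cvg_norm; apply: cvgB; last exact: cvg_cst.
  by under eq_fun do rewrite /S box_sum.
have H2 : (sa M ^+ m - sa N ^+ m) @[M --> \oo] -->
    limn (series (fun n => `|a n.+1|)) ^+ m - sa N ^+ m.
  by apply: cvgB => //; exact: cvg_cst.
apply: (@le_trans _ _ (limn (series (fun n => `|a n.+1|)) ^+ m - sa N ^+ m));
  last first.
  exact: le_trans (ler_norm _) HN.
apply: (ler_cvg_to H1 H2).
have := box_exhaust A; apply: filterS => M AM.
apply: (@le_trans _ _ (Sa (box m M) - Sa A)).
  by rewrite !partial_sum_diff//; exact: ler_norm_sum.
rewrite SaE box_sum lerD2l lerN2 -(box_sum m N (fun i => `|a i|)) -SaE.
rewrite -subr_ge0 partial_sum_diff//; apply: sumr_ge0 => q _.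
exact: normr_ge0.
Qed.

End TupleSums.

(** * Differentiation under the integral sign *)

Section UnderIntegral.
Context {R : realType}.
Implicit Types f g u v : R -> R.

Lemma rectangle_bounded (f : R -> R -> R) (a b : R) : 0 < a ->
  {within [set p : R * R | 0 < p.1 /\ p.2 \in `[0, 1]],
    continuous (fun p : R * R => f p.1 p.2)} ->
  exists2 M, 0 < M & forall t x : R, t \in `[a, b] -> x \in `[0, 1] ->
    `|f t x| <= M.
Proof.
move=> a0 cf; pose K := (`[a, b]%classic `*` `[0, 1]%classic) : set (R * R).
have cK : compact K by apply: compact_setX; exact: segment_compact.
have KA : K `<=` [set p : R * R | 0 < p.1 /\ p.2 \in `[0, 1]].
  move=> [t x] [/= + x01]; rewrite in_itv /= => /andP[at_ _].
  by split => //; exact: lt_le_trans a0 at_.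
have := compact_bounded (continuous_compact (continuous_subspaceW KA cf) cK).
move=> /pinfty_ex_gt0[M M0 HM]; exists M => // t x tab x01.
by apply: HM; exists (t, x).
Qed.

(** The Burgers equation provides a time derivative at interior points only, so differentiation
    under the integral sign takes place over an open interval with the same integral. *)
Lemma prim01_oo f x : x \in `[0, 1] -> leb.-integrable `[0, 1] (EFin \o f) ->
  \int[leb]_(s in `]0, x[) f s = prim01 f x.
Proof.
move=> x01 fi; have fx := integrableS01 x01 fi.
have fox : leb.-integrable `]0, x] (EFin \o f).
  by apply: integrableS fx => //; exact: subset_itv_oc_cc.
rewrite Rintegral_itv_bndo_bndc; last first.
  by apply: integrableS fx => //; exact: subset_itv_oo_cc.
by rewrite Rintegral_itv_obnd_cbnd.
Qed.

Lemma is_derive_prim01 (f f' : R -> R -> R) (a b t0 x M : R) :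
  t0 \in `]a, b[ -> x \in `[0, 1] ->
  (forall t, t \in `]a, b[ -> cont01 (f t)) -> cont01 (f' t0) ->
  (forall t s : R, t \in `]a, b[ -> s \in `]0, 1[ ->
     is_derive t 1 (f ^~ s) (f' t s) /\ `|f' t s| <= M) ->
  is_derive t0 1 (fun t => prim01 (f t) x) (prim01 (f' t0) x).
Proof.
move=> tab x01 cf cf' df.
have sub s : s \in `]0, x[ -> s \in `]0, 1[.
  move: x01; rewrite !in_itv /= => /andP[_ x1] /andP[-> sx] /=.
  exact: lt_le_trans sx x1.
have mB : measurable (`]0, x[ : set R) by [].
have intf t : t \in `]a, b[ -> leb.-integrable `]0, x[ (EFin \o f t).
  move=> /cf /cont01_integrable fi.
  by apply: integrableS fi => // s /sub; exact: in01W.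
have derf t s : t \in `]a, b[ -> s \in `]0, x[ -> derivable (f ^~ s) t 1.
  by move=> tI /sub sI; have [[]] := df t s tI sI.
have d1E t s : t \in `]a, b[ -> s \in `]0, x[ ->
    partial1of2 f t s = f' t s.
  move=> tI /sub sI; rewrite partial1of2E.
  by have [dft _] := df t s tI sI; rewrite derive_val.
have iM : leb.-integrable `]0, x[ (EFin \o (fun=> `|M|)).
  have ci : leb.-integrable `[0, 1] (EFin \o (fun=> `|M|)).
    exact/cont01_integrable/cont01_cst.
  by apply: integrableS ci => // s /sub; exact: in01W.
have G_ub t s : t \in `]a, b[ -> s \in `]0, x[ -> `|partial1of2 f t s| <= `|M|.
  move=> tI sI; rewrite d1E//; have [_ H] := df t s tI (sub _ sI).
  exact: le_trans H (ler_norm _).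
have := @cvg_differentiation_under_integral R _ _ leb f _ mB t0 a b tab
  intf derf (fun=> `|M|) (fun=> normr_ge0 M) iM G_ub.
have -> : \int[leb]_(s in `]0, x[) partial1of2 f t0 s = prim01 (f' t0) x.
  rewrite -(prim01_oo x01 (cont01_integrable cf')).
  by apply: eq_Rintegral => s; rewrite inE => sI; exact: d1E.
move=> H; apply: (near_eq_is_derive (f := fun t =>
  \int[leb]_(s in `]0, x[) f t s)).
  near=> t; apply: prim01_oo => //; apply: cont01_integrable; apply: cf.
  by near: t; exact: near_in_itvoo.
have {}H : h^-1 *: ((\int[leb]_(s in `]0, x[) f (h *: 1 + t0) s) -
    (\int[leb]_(s in `]0, x[) f t0 s)) @[h --> 0^'] --> prim01 (f' t0) x.
  by under eq_fun do rewrite scaler1.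
apply: DeriveDef; first by apply/cvg_ex; exists (prim01 (f' t0) x).
by rewrite /derive; apply/cvg_lim.
Unshelve. all: by end_near. Qed.

Lemma cont01_expR f : cont01 f -> cont01 (fun x => expR (f x)).
Proof. by move=> cf; apply: (@cont01_comp _ expR) => //;
  exact: continuous_expR. Qed.

Lemma C1_01_expR f g : C1_01 f g ->
  C1_01 (fun x => expR (f x)) (fun x => g x * expR (f x)).
Proof.
move=> [cf cg df]; have ce := cont01_expR cf.
split => //; first exact: cont01M.
move=> x x01; have dfx := df x x01.
have := @is_derive1_comp R expR f x (expR (f x)) (g x) _ _.
by rewrite mulrC; apply.
Qed.

Lemma expR_dist (h d : R) : `|h| <= d -> `|expR h - 1| <= expR d - 1.
Proof.
rewrite ler_norml => /andP[dh hd].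
rewrite ler_norml lerD2r ler_expR hd andbT.
have : expR (- d) <= expR h by rewrite ler_expR.
rewrite expRN.
have := expR_gt0 d; move: (expR d) (expR h) => a b a0 ab.
(* The lower bound [1 - expR (- d) <= expR d - 1] is the inequality [a + a^-1 >= 2]. *)
have : 0 <= (a - 1) ^+ 2 / a by rewrite divr_ge0 ?sqr_ge0// ltW.
have -> : (a - 1) ^+ 2 / a = a + a^-1 - 2 by field; rewrite gt_eqF.
by move: ab; clear; lra.
Qed.

(** The error is relative to the value at [v]; this form survives integration and division by the
    mass, as [cole_hopf_dist] requires. *)
Lemma expR_prim_dist u v x : L2_01 u -> L2_01 v -> x \in `[0, 1] ->
  `|expR (- 2^-1 * prim01 u x) - expR (- 2^-1 * prim01 v x)| <=
  expR (- 2^-1 * prim01 v x) * (expR (2^-1 * l2norm (u \- v)) - 1).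
Proof.
move=> uL vL x01.
have -> : - 2^-1 * prim01 u x =
    - 2^-1 * prim01 v x + - 2^-1 * (prim01 u x - prim01 v x) by ring.
rewrite expRD -{2}[expR (- 2^-1 * prim01 v x)]mulr1 -mulrBr normrM.
rewrite gtr0_norm ?expR_gt0// ler_pM2l ?expR_gt0//; apply: expR_dist.
rewrite normrM normrN (@ger0_norm _ 2^-1)//.
rewrite ler_pM2l//.
rewrite /prim01 -RintegralB//; last 2 first.
- exact: integrableS01 (L2_01_integrable uL).
- exact: integrableS01 (L2_01_integrable vL).
by apply: Rintegral_le_l2norm => //; exact: L2_01B.
Qed.

Lemma cont01_lower_bound f : cont01 f ->
  (forall x : R, x \in `[0, 1] -> 0 < f x) ->
  exists2 m, 0 < m & forall x : R, x \in `[0, 1] -> m <= f x.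
Proof.
move=> cf f0; have [c c01 Hc] := EVT_min ler01 cf.
by exists (f c); [exact: f0|move=> x /Hc].
Qed.

Lemma l2dot_gt0 f g : cont01 f -> cont01 g ->
  (forall x : R, x \in `[0, 1] -> 0 < f x) ->
  (forall x : R, x \in `[0, 1] -> 0 < g x) -> 0 < l2dot f g.
Proof.
move=> cf cg f0 g0; have cfg := cont01M cf cg.
have [m m0 Hm] := cont01_lower_bound cfg (fun x x01 =>
  mulr_gt0 (f0 x x01) (g0 x x01)).
apply: (@lt_le_trans _ _ (\int[leb]_(x in `[0%R, 1%R]) m)).
  by rewrite Rintegral_cst//= lebesgue_measure_itv/= lte_fin ltr01 sube0 mulr1.
apply: le_Rintegral => //; [|exact: cont01_integrable].
by apply: cont01_integrable; exact: cont01_cst.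
Qed.

End UnderIntegral.

(** * The Cole-Hopf transform of a Burgers solution *)

Section ColeHopf.
Context {R : realType}.
Variables (V : R -> R) (mu : nat -> R) (e : nat -> R -> R).
Hypothesis smoothV : smooth01 V.
Hypothesis eigen : neumann_eigensystem V mu e.
Variables (u0 : R -> R) (u : R -> R -> R).
Hypothesis u0_L2 : L2_01 u0.
Hypothesis burgers : burgers_solution V u0 u.

Let uL2 t : 0 <= t -> L2_01 (u t).
Proof. by case: burgers => -[+ _ _] _ _ _ _; exact. Qed.

Let uC1 t k : 0 < t -> C1_01 (iter k D01 (u t)) (iter k.+1 D01 (u t)).
Proof. by case: burgers => _ + _ _ _ => su /su; exact: smooth01_C1. Qed.

Let ux t := D01 (u t).
Let uxx t := D01 (D01 (u t)).

Let u_C1 t : 0 < t -> C1_01 (u t) (ux t).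
Proof. exact: (uC1 0). Qed.

Let ux_C1 t : 0 < t -> C1_01 (ux t) (uxx t).
Proof. exact: (uC1 1). Qed.

Let V_C1 : C1_01 V (D01 V).
Proof. exact: (@smooth01_C1 _ _ 0). Qed.

(* Potential of u, i.e. -2 log of the unnormalised Cole-Hopf transform w. *)
Let W t := prim01 (u t).

Definition hopf_w (v : R -> R) (x : R) := expR (- 2^-1 * prim01 v x).

Let w t := hopf_w (u t).

Lemma hopf_w_cont v : L2_01 v -> cont01 (hopf_w v).
Proof.
move=> vL; apply: cont01_expR; apply: cont01M; first exact: cont01_cst.
exact/prim01_cont/L2_01_integrable.
Qed.

Let w_cont t : 0 <= t -> cont01 (w t).
Proof. by move=> /uL2; exact: hopf_w_cont. Qed.

Let wx t x := - 2^-1 * u t x * w t x.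

Let wxx t x := (- 2^-1 * ux t x + 4^-1 * u t x ^+ 2) * w t x.

Let w_C1 t : 0 < t -> C1_01 (w t) (wx t).
Proof.
move=> t0; have [cu _ _] := u_C1 t0.
exact: C1_01_expR (C1_01Z (- 2^-1) (prim01_C1 cu)).
Qed.

Let wx_C1 t : 0 < t -> C1_01 (wx t) (wxx t).
Proof.
move=> t0; have := C1_01M (C1_01Z (- 2^-1) (u_C1 t0)) (w_C1 t0).
by apply: eq_C1_01 => x _; rewrite /wx /wxx; field.
Qed.

Let u_bc t : 0 < t -> u t 0 = 0 /\ u t 1 = 0.
Proof. by case: burgers => _ _ _ _; exact. Qed.

(* ut is read off the equation, and Wt is its integral over [0, x]. *)
Let ut t x := uxx t x - u t x * ux t x + 2 * D01 V x.

Let Wt t x :=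
  ux t x - ux t 0 - 2^-1 * u t x ^+ 2 + 2 * (V x - V 0).

Let ut_derive (t x : R) : 0 < t -> x \in `]0, 1[ ->
  is_derive t 1 (u ^~ x) (ut t x).
Proof.
case: burgers => _ _ _ + _ => H t0 x01; have [du E] := H t x t0 x01.
apply: DeriveDef => //; rewrite -derive1E.
have -> : ut t x = uxx t x + 2 * D01 V x - u t x * ux t x.
  by rewrite /ut addrAC.
by rewrite /uxx -E addrK.
Qed.

Let ut_cont t : 0 < t -> cont01 (ut t).
Proof.
move=> t0; have [cu cux _] := u_C1 t0; have [_ cuxx _] := ux_C1 t0.
apply: cont01D; last by apply: cont01M; [exact: cont01_cst|case: V_C1].
by apply: cont01B => //; exact: cont01M.
Qed.

(** In conservation form [ut] is the space derivative of [ux - u^2 / 2 + 2 V]; the value of [u^2] at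
    0 vanishes by the Dirichlet condition. *)
Let prim_ut t x : 0 < t -> x \in `[0, 1] -> prim01 (ut t) x = Wt t x.
Proof.
move=> t0 x01.
have [bc0 _] := u_bc t0.
have C : C1_01 (fun x => ux t x - 2^-1 * u t x ^+ 2 + 2 * V x) (ut t).
  have := C1_01D (C1_01D (ux_C1 t0)
    (C1_01Z (- 2^-1) (C1_01M (u_C1 t0) (u_C1 t0)))) (C1_01Z 2 V_C1).
  set F := (X in C1_01 X _); set f := (X in C1_01 _ X).
  have -> : F = (fun x => ux t x - 2^-1 * u t x ^+ 2 + 2 * V x).
    by apply/funext => y; rewrite /F mulNr expr2.
  by apply: eq_C1_01 => y _; rewrite /f /ut; field.
by rewrite /prim01 (C1_01_FTC C x01) bc0 /Wt; ring.
Qed.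

Let rect_bound a b : 0 < a -> exists2 M, 0 < M & forall t x : R,
  t \in `[a, b] -> x \in `[0, 1] ->
  [/\ `|u t x| <= M, `|ux t x| <= M & `|uxx t x| <= M].
Proof.
move=> a0; case: burgers => _ _ cu _ _.
have [M0 M00 H0] := @rectangle_bounded R (fun t =>
  iter 0 D01 (u t)) a b a0 (cu 0%N isT).
have [M1 M10 H1] := @rectangle_bounded R (fun t =>
  iter 1 D01 (u t)) a b a0 (cu 1%N isT).
have [M2 M20 H2] := @rectangle_bounded R (fun t =>
  iter 2 D01 (u t)) a b a0 (cu 2%N isT).
exists (M0 + M1 + M2); first by rewrite !addr_gt0.
move=> t x tab x01; split.
- by apply: (le_trans (H0 t x tab x01)); rewrite -addrA lerDl addr_ge0// ltW.
- apply: (le_trans (H1 t x tab x01)).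
  by rewrite [M0 + M1]addrC -addrA lerDl addr_ge0// ltW.
- by apply: (le_trans (H2 t x tab x01)); rewrite lerDr addr_ge0// ltW.
Qed.

(** A window around [t] that stays away from time 0, where [u] and its space derivatives have
    uniform bounds to serve as domination. *)
Let time_box t : 0 < t ->
  [/\ 0 < t / 2, t \in `]t / 2, t * 2[ & forall s : R, s \in `]t / 2, t * 2[ ->
      0 < s /\ s \in `[t / 2, t * 2]].
Proof.
move=> t0; have t20 : 0 < t / 2 by rewrite divr_gt0.
split => //.
  by rewrite in_itv /= ltr_pdivrMr// ltr_pMr// ltr1n.
move=> s sI; split; last exact: subset_itv_oo_cc.
by move: sI; rewrite in_itv /= => /andP[+ _]; exact: lt_trans.
Qed.

Let W_derive (t x : R) : 0 < t -> x \in `[0, 1] ->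
  is_derive t 1 (W ^~ x) (Wt t x).
Proof.
move=> t0 x01; have [a0 tI sI] := time_box t0.
have [M M0 HM] := rect_bound (t * 2) a0.
have [MV MV0 HV] := cont01_bounded (let: And3 _ h _ := V_C1 in h).
rewrite -prim_ut//.
apply: (@is_derive_prim01 _ u ut (t / 2) (t * 2) t x (M + M * M + 2 * MV)) =>
  //.
- by move=> s /sI[s0 _]; have [] := u_C1 s0.
- exact: ut_cont.
move=> s y /sI[s0 sI'] y01; split; first exact: ut_derive.
have [h0 h1 h2] := HM s y sI' (in01W y01).
rewrite /ut; apply: (le_trans (ler_normD _ _)); apply: lerD; last first.
  by rewrite normrM (@ger0_norm _ 2)// ler_pM2l// HV// in01W.
apply: (le_trans (ler_normB _ _)); apply: lerD => //.
by rewrite normrM ler_pM.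
Qed.

Let w_derive (t x : R) : 0 < t -> x \in `[0, 1] ->
  is_derive t 1 (w ^~ x) (- 2^-1 * Wt t x * w t x).
Proof.
move=> t0 x01; have dW := W_derive t0 x01.
have dc : is_derive t 1 (fun s => - 2^-1 * W s x) (- 2^-1 * Wt t x).
  exact: is_deriveZ.
have := @is_derive1_comp R expR (fun s => - 2^-1 * W s x) t _ _
  (is_derive_expR _) dc.
by rewrite mulrC.
Qed.

Definition hopf_coef n t := l2dot (e n) (w t).

Let hopf_coef_derive_raw n (t : R) : 0 < t -> is_derive t 1 (hopf_coef n)
  (l2dot (e n) (fun x => - 2^-1 * Wt t x * w t x)).
Proof.
move=> t0; have [a0 tI sI] := time_box t0.
have [M M0 HM] := rect_bound (t * 2) a0.
have [MV MV0 HV] := cont01_bounded (let: And3 h _ _ := V_C1 in h).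
have [Me Me0 He] := cont01_bounded (@eigen_cont _ _ _ _ eigen n).
have cWt s : 0 < s -> cont01 (fun x => - 2^-1 * Wt s x * w s x).
  move=> s0; apply: cont01M; last exact/w_cont/ltW.
  apply: cont01M; first exact: cont01_cst.
  apply: (@eq_cont01 _ (prim01 (ut s))); first by move=> x x01; rewrite prim_ut.
  exact/prim01_cont/cont01_integrable/ut_cont.
(* [hopf_coef n] is the primitive evaluated at 1. In the dominating constant, [Me] bounds [e n], the
   middle factor bounds half of [Wt] term by term, and the exponential bounds [w] because the
   primitive of [u] is at most [M] in absolute value. *)
apply: (@is_derive_prim01 _ (fun s x => e n x * w s x)
  (fun s x => e n x * (- 2^-1 * Wt s x * w s x)) (t / 2) (t * 2) t 1
  (Me * (2^-1 * (M + M + 2^-1 * (M * M) + 2 * (MV + MV)) * expR (2^-1 * M))))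
    => //.
- exact: one_in01.
- move=> s /sI[s0 _]; apply: cont01M; first exact: (eigen_cont eigen).
  exact/w_cont/ltW.
- by apply: cont01M; [exact: (eigen_cont eigen)|exact: cWt].
move=> s x /sI[s0 sI'] x01o; have x01 := in01W x01o; split.
  by have := is_deriveZ (e n x) (w_derive s0 x01).
have uM y (y01 : y \in `[0, 1]) : `|u s y| <= M by have [] := HM s y sI' y01.
rewrite normrM; apply: ler_pM => //; first exact: He.
rewrite normrM; apply: ler_pM => //.
  rewrite normrM normrN (@ger0_norm _ 2^-1)// ler_pM2l//.
  have [h0 h1 _] := HM s x sI' x01.
  have [_ h10 _] := HM s 0 sI' zero_in01.
  rewrite /Wt; apply: (le_trans (ler_normD _ _)); apply: lerD; last first.
    rewrite normrM (@ger0_norm _ 2)// ler_pM2l//;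
      apply: (le_trans (ler_normB _ _)).
    by apply: lerD; apply: HV => //; exact: zero_in01.
  apply: (le_trans (ler_normB _ _)); apply: lerD; last first.
    by rewrite normrM (@ger0_norm _ 2^-1)// ler_pM2l// expr2 normrM ler_pM.
  by apply: (le_trans (ler_normB _ _)); exact: lerD.
rewrite ger0_norm ?expR_ge0// ler_expR.
apply: (le_trans (ler_norm _)); rewrite normrM normrN (@ger0_norm _ 2^-1)//
  ler_pM2l//.
apply: (le_trans (Rintegral_le_l2norm (uL2 (ltW s0)) x01)).
by apply: l2norm_le_sup; [have [] := u_C1 s0|exact: ltW|exact: uM].
Qed.

(** The integration constant: -1/2 times the part of [Wt] that comes from evaluation at the endpoint
    0. *)
Let k t := V 0 + 2^-1 * ux t 0.

(* The left-hand side is the time derivative of w. *)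
Let heat_equation t x : - 2^-1 * Wt t x * w t x = wxx t x + (k t - V x) * w t x.
Proof. by rewrite /Wt /wxx /k; field. Qed.

(** Two integrations by parts move the second derivative onto [e n]. The first boundary term
    vanishes since [wx] contains the factor [u], zero at both ends, the second by the Neumann
    condition; the contributions of V cancel. *)
Lemma hopf_coef_derive n (t : R) : 0 < t ->
  is_derive t 1 (hopf_coef n) ((k t - mu n) * hopf_coef n t).
Proof.
move=> t0; suff <- : l2dot (e n) (fun x => - 2^-1 * Wt t x * w t x) =
    (k t - mu n) * hopf_coef n t by exact: hopf_coef_derive_raw.
have en_C1 := eigen_C1 eigen n; have en_C2 := eigen_C2 smoothV eigen n.
have [cV _ _] := V_C1; have [_ cwxx _] := wx_C1 t0.
have cw := w_cont (ltW t0); have ce := @eigen_cont _ _ _ _ eigen n.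
have [ut0 ut1] := u_bc t0.
have eL := eigen_L2 eigen n.
have cVw : cont01 (fun x => V x * w t x) by exact: cont01M.
have -> : (fun x => - 2^-1 * Wt t x * w t x) =
    (fun x => (wxx t x + k t * w t x) - V x * w t x).
  by apply/funext => x; rewrite heat_equation; ring.
have ckw : cont01 (fun x => k t * w t x) by apply: cont01M => //;
  exact: cont01_cst.
rewrite l2dotBr//; [|exact/cont01_L2/cont01D|exact: cont01_L2].
rewrite l2dotDr//; [|exact: cont01_L2..].
rewrite l2dotZr//; last exact: cont01_L2.
have := C1_01_ibp en_C1 (wx_C1 t0).
rewrite /wx ut0 ut1 !mulr0 !mul0r !mulr0 subrr sub0r => ->.
have := C1_01_ibp en_C2 (w_C1 t0).
rewrite (eigen_D0 eigen) (eigen_D1 eigen) !mul0r subrr sub0r => ->.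
rewrite opprK.
have -> : l2dot (fun x => (V x - mu n) * e n x) (w t) =
    l2dot (e n) (fun x => V x * w t x - mu n * w t x).
  by apply: eq_Rintegral => x _; ring.
rewrite l2dotBr//; [|exact: cont01_L2|]; last first.
  by apply/cont01_L2/cont01M => //; exact: cont01_cst.
rewrite l2dotZr//; last exact: cont01_L2.
by rewrite /hopf_coef; ring.
Qed.

End ColeHopf.

(** * Coefficient ratios of the Cole-Hopf transform and their evolution *)

Section KoopmanRatio.
Context {R : realType}.
Variables (V : R -> R) (mu : nat -> R) (e : nat -> R -> R).
Hypothesis smoothV : smooth01 V.
Hypothesis eigen : neumann_eigensystem V mu e.

Lemma hopf_w_l2dist (v : R -> R) : L2_01 v -> exists2 K, 0 < K &
  forall v', L2_01 v' ->
  l2norm (fun x => hopf_w v' x - hopf_w v x) <=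
    K * (expR (2^-1 * l2norm (v' \- v)) - 1).
Proof.
move=> vL; have cw := hopf_w_cont vL.
have [K K0 HK] := cont01_bounded cw.
exists K => // v' v'L.
have e0 : 0 <= expR (2^-1 * l2norm (v' \- v)) - 1.
  by rewrite subr_ge0 -[leLHS]expR0 ler_expR mulr_ge0// l2norm_ge0.
apply: l2norm_le_sup.
- by apply: cont01B => //; exact: hopf_w_cont.
- by rewrite mulr_ge0// ltW.
move=> x x01; apply: (le_trans (expR_prim_dist v'L vL x01)).
by rewrite ler_wpM2r//; apply: le_trans (HK _ x01); exact: ler_norm.
Qed.

Lemma hopf_w_mass_gt0 (v : R -> R) : L2_01 v ->
  0 < \int[leb]_(x in `[0, 1]) hopf_w v x.
Proof.
move=> vL; have cw := hopf_w_cont vL.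
have c1 : cont01 (fun=> 1 : R) by exact: cont01_cst.
have -> : \int[leb]_(x in `[0, 1]) hopf_w v x = l2dot (fun=> 1) (hopf_w v).
  by apply: eq_Rintegral => x _; rewrite mul1r.
by apply: l2dot_gt0 => // x _; exact: expR_gt0.
Qed.

Lemma cole_hopfE (v : R -> R) : cole_hopf v =
  (fun x => (\int[leb]_(y in `[0, 1]) hopf_w v y)^-1 * hopf_w v x).
Proof. by apply/funext => x; rewrite mulrC. Qed.

Lemma cole_hopf_cont (v : R -> R) : L2_01 v -> cont01 (cole_hopf v).
Proof.
move=> vL; rewrite cole_hopfE; apply: cont01M; first exact: cont01_cst.
exact: hopf_w_cont.
Qed.

Lemma cole_hopf_dot n (v : R -> R) : L2_01 v -> l2dot (e n) (cole_hopf v) =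
  (\int[leb]_(y in `[0, 1]) hopf_w v y)^-1 * l2dot (e n) (hopf_w v).
Proof.
move=> vL; rewrite cole_hopfE l2dotZr//; first exact: (eigen_L2 eigen).
exact/cont01_L2/hopf_w_cont.
Qed.

Lemma hopf_w_dot0_gt0 (v : R -> R) : L2_01 v -> 0 < l2dot (e 0%N) (hopf_w v).
Proof.
move=> vL; apply: l2dot_gt0; first exact: (eigen_cont eigen).
- exact: hopf_w_cont.
- exact: (eigen0_gt0 eigen).
- by move=> x _; exact: expR_gt0.
Qed.

Variables (u0 : R -> R) (u : R -> R -> R).
Hypothesis u0_L2 : L2_01 u0.
Hypothesis burgers : burgers_solution V u0 u.

Let uL2 (t : R) : 0 <= t -> L2_01 (u t).
Proof. by case: burgers => -[+ _ _] _ _ _ _; exact. Qed.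

Let c n t := hopf_coef e u n t.

Lemma hopf_coef0_gt0 t : 0 <= t -> 0 < c 0%N t.
Proof. by move=> t0; apply: hopf_w_dot0_gt0; exact: uL2. Qed.

(** The differential equation says nothing at time 0. L^2 continuity of [u] passes to [hopf_w]
    through the exponential estimate, then to the coefficient by Cauchy-Schwarz. *)
Lemma hopf_coef_cvg0 n : c n t @[t --> (0 : R)^'+] --> c n 0.
Proof.
have u0L := uL2 (lexx 0).
have [K K0 HK] := hopf_w_l2dist u0L.
have nu0 : l2norm (u t \- u 0) @[t --> (0 : R)^'+] --> 0.
  case: burgers => -[_ H _] _ _ _ _; apply: cvg_trans (H 0 (lexx 0)).
  apply: cvg_app; apply: within_subset => s /=.
  by rewrite in_itv /= andbT; exact: ltW.
have H : K * (expR (2^-1 * l2norm (u t \- u 0)) - 1) @[t --> (0 : R)^'+] --> 0.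
  rewrite -[X in _ --> X](mulr0 K) -[X in _ --> K * X](subrr (1 : R)).
  apply: cvgM; first exact: cvg_cst.
  apply: cvgB; last exact: cvg_cst.
  have h2 : 2^-1 * l2norm (u t \- u 0) @[t --> (0 : R)^'+] --> (2^-1 * 0 : R).
    by apply: cvgM; [exact: cvg_cst|exact: nu0].
  have := cvg_comp _ _ h2 (@continuous_expR R (2^-1 * 0)).
  by rewrite mulr0 expR0.
apply/cvgrPdist_le => eps eps0.
move/cvgrPdist_le : H => /(_ eps eps0) H; near=> t.
have t0 : 0 <= t by near: t; exact: nbhs_right_ge.
have eL := eigen_L2 eigen n.
have wL s : 0 <= s -> L2_01 (hopf_w (u s)).
  by move=> /uL2 /hopf_w_cont; exact: cont01_L2.
rewrite distrC /c /hopf_coef -l2dotBr//; [|exact: wL..].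
apply: (le_trans (l2dot_CS eL (L2_01B (wL _ t0) (wL _ (lexx 0))))).
rewrite (eigen_norm eigen) mul1r; apply: (le_trans (HK _ (uL2 t0))).
have : `|0 - K * (expR (2^-1 * l2norm (u t \- u 0)) - 1)| <= eps by near: t.
by rewrite sub0r normrN; apply: le_trans; exact: ler_norm.
Unshelve. all: by end_near. Qed.

Lemma expR_ratio (a b g s : R) :
  a * expR (g * s) = b * expR (g * 0) -> a = expR (- g * s) * b.
Proof.
rewrite mulr0 expR0 mulr1 => <-.
by rewrite mulrCA -expRD mulNr addNr expR0 mulr1.
Qed.

(** The ratio times [expR (g * s)] has zero derivative for [s > 0]. It is thus constant on every
    segment from a positive [s] to [t], and letting [s] tend to 0 from the right identifies the
    constant. *)
Lemma hopf_coef_ratio n (t : R) : 0 < t ->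
  c n t / c 0%N t = expR (- (mu n - mu 0%N) * t) * (c n 0 / c 0%N 0).
Proof.
move=> t0; set g := mu n - mu 0%N.
pose h s := c n s * (c 0%N s)^-1 * expR (g * s).
have dh (s : R) : 0 < s -> is_derive s 1 h 0.
  move=> s0; have c0 : c 0%N s != 0 by rewrite gt_eqF// hopf_coef0_gt0// ltW.
  have dn := hopf_coef_derive smoothV eigen burgers n s0.
  have d0 := hopf_coef_derive smoothV eigen burgers 0%N s0.
  have dV := is_deriveV c0 d0.
  have dg : is_derive s 1 (fun s => g * s) (g * 1) by exact: is_deriveZ.
  have dE := @is_derive1_comp R expR (fun s =>
    g * s) s _ _ (is_derive_expR _) dg.
  have := is_deriveM (is_deriveM dn dV) dE.
  rewrite /GRing.scale /=.
  set D := (X in is_derive _ _ _ X).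
  suff -> : D = 0 by [].
  rewrite /D -/(c n s) -/(c 0%N s) /g.
  rewrite -[(hopf_coef e u n * _) s]/(c n s * (c 0%N s)^-1).
  by field.
have hconst (s : R) : 0 < s -> s <= t -> h t = h s.
  move=> s0 st.
  have dh' (r : R) : r \in `]s, t[ -> is_derive r 1 h ((fun=> 0) r).
    by rewrite in_itv /= => /andP[sr _]; apply: dh; exact: lt_trans sr.
  have ch : {within `[s, t], continuous h}.
    apply: derivable_within_continuous => r; rewrite in_itv /= => /andP[sr _].
    by have [] := dh r (lt_le_trans s0 sr).
  have [r _] := @MVT_segment R h (fun=> 0) s t st dh' ch.
  by rewrite mul0r => /eqP; rewrite subr_eq0 => /eqP.
have h0 : h s @[s --> (0 : R)^'+] --> h 0.
  apply: cvgM; first apply: cvgM.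
  - exact: hopf_coef_cvg0.
  - by apply: cvgV; [rewrite gt_eqF// hopf_coef0_gt0|exact: hopf_coef_cvg0].
  - apply: cvg_at_right_filter.
    have h2 : g * s @[s --> 0] --> g * 0.
      by apply: cvgM; [exact: cvg_cst|exact: cvg_id].
    exact: (cvg_comp _ _ h2 (@continuous_expR R _)).
have h1 : h s @[s --> (0 : R)^'+] --> h t.
  apply: cvg_near_cst; near=> s; apply/esym/hconst.
    by near: s; exact: nbhs_right_gt.
  by apply/ltW; near: s; exact: nbhs_right_lt.
have E : h t = h 0 by exact: (cvg_unique _ h1 h0).
exact: expR_ratio E.
Unshelve. all: by end_near. Qed.

(** [u 0] and [u0] agree almost everywhere only, which is enough for their primitives to agree
    everywhere. *)
Let u0E : {in `[0, 1], hopf_w (u 0) =1 hopf_w u0}.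
Proof.
move=> x x01; rewrite /hopf_w; congr (expR (_ * _)).
case: burgers => -[_ _ ae0] _ _ _ _.
by apply: ae_eq_Rintegral01 => //; apply: L2_01_measurable => //; exact: uL2.
Qed.

Lemma hopf_coef_init n : c n 0 = l2dot (e n) (hopf_w u0).
Proof. exact: eq_l2dot. Qed.

Definition koopman_ratio (v : R -> R) n :=
  l2dot (e n) (cole_hopf v) / l2dot (e 0%N) (cole_hopf v).

Lemma koopman_ratioE v n : L2_01 v ->
  koopman_ratio v n = l2dot (e n) (hopf_w v) / l2dot (e 0%N) (hopf_w v).
Proof.
move=> vL; rewrite /koopman_ratio !cole_hopf_dot// invfM mulrACA mulfV ?mul1r//.
by rewrite invr_eq0 gt_eqF// hopf_w_mass_gt0.
Qed.

Lemma koopman_ratio_bounded v : L2_01 v ->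
  exists B, forall n, `|koopman_ratio v n| <= B.
Proof.
move=> vL; exists (l2norm (hopf_w v) / l2dot (e 0%N) (hopf_w v)) => n.
have c0 := hopf_w_dot0_gt0 vL.
rewrite koopman_ratioE// normrM normfV [`|l2dot (e 0%N) _|]gtr0_norm//.
rewrite ler_pM2r ?invr_gt0//.
have wL : L2_01 (hopf_w v) by exact/cont01_L2/hopf_w_cont.
by apply: (le_trans (l2dot_CS (eigen_L2 eigen n) wL));
  rewrite (eigen_norm eigen) mul1r.
Qed.

Lemma hopf_coef_heat n t : 0 < t ->
  c n t = c 0%N t * heat_coef mu (koopman_ratio u0) t n.
Proof.
move=> t0; rewrite /heat_coef koopman_ratioE// -!hopf_coef_init.
rewrite -hopf_coef_ratio// mulrC divfK// gt_eqF// hopf_coef0_gt0//.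
exact: ltW.
Qed.

End KoopmanRatio.

(** * The Koopman decomposition *)

Section Decomposition.
Context {R : realType}.
Variables (V : R -> R) (mu : nat -> R) (e : nat -> R -> R) (C1 : R).
Hypothesis smoothV : smooth01 V.
Hypothesis Vpos : forall x : R, x \in `[0, 1] -> 0 < V x.
Hypothesis eigen : neumann_eigensystem V mu e.
Hypothesis C1_gt0 : 0 < C1.
Hypothesis sobolev : sobolev_constant C1.

Lemma m0_le (x : R) : x \in `[0, 1] -> m0 e <= e 0%N x.
Proof.
move=> x01; apply: ge_inf; last by exists x.
exists 0 => y [z z01 <-]; exact/ltW/(eigen0_gt0 eigen).
Qed.

Lemma m0_gt0 : 0 < m0 e.
Proof.
have [m m_gt0 Hm] :=
  cont01_lower_bound (@eigen_cont _ _ _ _ eigen 0%N) (eigen0_gt0 eigen).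
apply: (lt_le_trans m_gt0); apply: lb_le_inf.
  by exists (e 0%N 0), 0 => //; exact: zero_in01.
by move=> y [z z01 <-]; exact: Hm.
Qed.

Lemma f0tildeE : f0tilde e =
  (fun x => (\int[leb]_(y in `[0, 1]) e 0%N y)^-1 * e 0%N x).
Proof. by apply/funext => x; rewrite /f0tilde mulrC. Qed.

Lemma f0tilde_cont : cont01 (f0tilde e).
Proof.
rewrite f0tildeE; apply: cont01M; first exact: cont01_cst.
exact: (eigen_cont eigen).
Qed.

Lemma f0tilde_dot n : n != 0%N -> l2dot (e n) (f0tilde e) = 0.
Proof.
move=> n0; rewrite f0tildeE l2dotZr; [|exact: (eigen_L2 eigen)..].
by rewrite (eigen_dot eigen) (negbTE n0) mulr0.
Qed.

Let d v := l2norm (cole_hopf v \- f0tilde e).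

(** [cole_hopf v] is a positive density of total mass one, and [e 0] is at least [m0] everywhere. *)
Lemma cole_hopf_dot0_ge v : L2_01 v -> m0 e <= l2dot (e 0%N) (cole_hopf v).
Proof.
move=> vL; rewrite (cole_hopf_dot eigen)//.
rewrite mulrC ler_pdivlMr ?hopf_w_mass_gt0//.
have cw := hopf_w_cont vL.
rewrite -RintegralZl//; last exact: cont01_integrable.
apply: le_Rintegral => //.
- by apply: cont01_integrable; apply: cont01M => //; exact: cont01_cst.
- by apply: cont01_integrable; apply: cont01M => //; exact: (eigen_cont eigen).
- by move=> x x01; rewrite ler_pM2r ?expR_gt0// m0_le.
Qed.

(** [f0tilde] is a multiple of [e 0], so subtracting it leaves the [n]-th coefficient unchanged;
    Cauchy-Schwarz then brings in the distance. *)
Lemma koopman_ratio_le v n : L2_01 v -> n != 0%N ->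
  `|koopman_ratio e v n| <= d v / m0 e.
Proof.
move=> vL n0; have c0 := cole_hopf_dot0_ge vL.
have c0_gt0 := lt_le_trans m0_gt0 c0.
have HL : L2_01 (cole_hopf v) by exact/cont01_L2/cole_hopf_cont.
have fL : L2_01 (f0tilde e) by exact/cont01_L2/f0tilde_cont.
rewrite /koopman_ratio normrM normfV [`|l2dot (e 0%N) _|]gtr0_norm//.
apply: ler_pM => //; [by rewrite invr_ge0 ltW|..];
  last by rewrite lef_pV2 ?posrE// m0_gt0.
rewrite -[l2dot (e n) _]subr0 -(f0tilde_dot n0) -l2dotBr//; last first.
  exact: (eigen_L2 eigen).
apply: (le_trans (l2dot_CS (eigen_L2 eigen n) (L2_01B HL fL))).
by rewrite (eigen_norm eigen) mul1r.
Qed.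

Section Core.
Variables (u0 : R -> R) (u : R -> R -> R) (t : R).
Hypothesis u0_L2 : L2_01 u0.
Hypothesis burgers : burgers_solution V u0 u.
Hypothesis t0 : 0 < t.
Hypothesis ht : h1 mu C1 t * d u0 < m0 e ^+ 2.

Let rho := koopman_ratio e u0.
Let r := heat_coef mu rho t.

Let r0 : r 0%N = 1.
Proof.
rewrite /r /heat_coef subrr oppr0 mul0r expR0 mul1r /rho /koopman_ratio.
rewrite divff// gt_eqF//; exact: lt_le_trans m0_gt0 (cole_hopf_dot0_ge u0_L2).
Qed.

Let F := heat_sum mu e rho t.
Let G := heat_sum1 mu e rho t.

(** Terms of [F / e 0]. The one of index 0 equals 1, and [z] collects the others. *)
Let a (x : R) n := r n * e n x / e 0%N x.
Let z x := limn (series (fun n => a x n.+1)).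

Let abs_cvg x : x \in `[0, 1] -> cvgn (series (fun n => `|a x n.+1|)).
Proof.
move=> x01; have [B rhoB] := koopman_ratio_bounded eigen u0_L2.
have := heat_sum_abs_cvg smoothV Vpos eigen C1_gt0 sobolev rhoB t0 x01.
have e0 := eigen0_gt0 eigen x01.
rewrite -(is_cvg_series_restrict 1) => /cvg_ex[l Hl].
have : cvgn (series (fun n => `|r n.+1 * e n.+1 x|)).
  apply/cvg_ex; exists l; move: Hl; rewrite -cvg_shiftS.
  apply: cvg_trans; apply: near_eq_cvg; apply: nearW => N.
  by rewrite /series /= big_add1.
have -> : (fun n => `|a x n.+1|) =
    (fun n => (e 0%N x)^-1 * `|r n.+1 * e n.+1 x|).
  by apply/funext => n; rewrite /a [LHS]normrM normfV (gtr0_norm e0) mulrC.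
exact: cvgn_seriesZ.
Qed.

Let z_cvg x : x \in `[0, 1] -> cvgn (series (fun n => a x n.+1)).
Proof. by move=> x01; apply: normed_cvg; exact: abs_cvg. Qed.

Let F_z x : x \in `[0, 1] -> F x = e 0%N x * (1 + z x).
Proof.
move=> x01; have e0 := eigen0_gt0 eigen x01.
have [B rhoB] := koopman_ratio_bounded eigen u0_L2.
have cF := heat_sum_cvg smoothV Vpos eigen C1_gt0 sobolev rhoB t0 x01.
suff H : series (fun k => r k * e k x) @ \oo --> e 0%N x * (1 + z x).
  exact: (cvg_unique _ cF H).
rewrite -cvg_shiftS.
have -> : (fun n => series (fun k => r k * e k x) n.+1) =
    (fun n => e 0%N x * (1 + series (fun k => a x k.+1) n)).
  apply/funext => n; rewrite /series /= big_nat_recl// r0 mul1r mulrDr mulr1.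
  congr (_ + _); rewrite mulr_sumr; apply: eq_bigr => k _.
  by rewrite /a [RHS]mulrC divfK// gt_eqF.
apply: cvgM; first exact: cvg_cst.
by apply: cvgD; [exact: cvg_cst|exact: z_cvg].
Qed.

(** The uniform tail bound, applied with [B = d u0 / m0] and divided by [e 0 x >= m0], holds for all
    partial sums and passes to the limit; [ht] makes it less than 1. *)
Let z_lt1 x : x \in `[0, 1] -> `|z x| < 1.
Proof.
move=> x01; have e0 := eigen0_gt0 eigen x01.
have m0p := m0_gt0.
have d0 : 0 <= d u0 by exact: l2norm_ge0.
have B0 : 0 <= d u0 / m0 e by rewrite divr_ge0// ltW.
apply: (@le_lt_trans _ _ (d u0 / m0 e * h1 mu C1 t / m0 e)); last first.
  have -> : d u0 / m0 e * h1 mu C1 t / m0 e = h1 mu C1 t * d u0 / m0 e ^+ 2.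
    by field; rewrite gt_eqF.
  by rewrite ltr_pdivrMr ?exprn_gt0// mul1r.
have cn : (`|series (fun n => a x n.+1) n|) @[n --> \oo] --> `|z x|.
  by apply: cvg_norm; exact: z_cvg.
rewrite -(cvg_lim _ cn)//; apply: limr_le; first by apply/cvg_ex; exists `|z x|.
apply: nearW => N.
have -> : series (fun n => a x n.+1) N =
    (\sum_(1 <= n < N.+1) r n * e n x) / e 0%N x.
  by rewrite /series /= big_add1 /= mulr_suml.
rewrite normrM normfV (gtr0_norm e0).
apply: ler_pM => //; [by rewrite invr_ge0 ltW| |by rewrite lef_pV2 ?posrE//
  m0_le].
apply: (heat_tail_sup smoothV Vpos eigen C1_gt0 sobolev) => // n n0.
exact: koopman_ratio_le.
Qed.

Let one_z x : x \in `[0, 1] -> 0 < 1 + z x.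
Proof. by move=> /z_lt1; rewrite ltr_norml -ltrBlDl sub0r => /andP[]. Qed.

(** Inside the interval [hopf_w (u t)] divided by its ground coefficient equals [F], and comparing
    derivatives gives the quotient. The endpoints are treated apart: there [u t] and [G] both
    vanish. *)
Let burgers_quotient x : x \in `[0, 1] -> u t x = - 2 * G x / F x.
Proof.
move=> x01; have [B rhoB] := koopman_ratio_bounded eigen u0_L2.
have bc : u t 0 = 0 /\ u t 1 = 0 by case: burgers => _ _ _ _; exact.
have [x0|xn0] := eqVneq x 0.
  by rewrite x0 /G (heat_sum1_0 eigen) mulr0 mul0r; case: bc.
have [x1|xn1] := eqVneq x 1.
  by rewrite x1 /G (heat_sum1_1 eigen) mulr0 mul0r; case: bc.
have x01o : x \in `]0, 1[.
  by move: x01; rewrite !in_itv /= !lt_neqAle eq_sym xn0 xn1.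
have utL : L2_01 (u t) by case: burgers => -[+ _ _] _ _ _ _; apply; exact: ltW.
have cu : C1_01 (u t) (D01 (u t)).
  by case: burgers => _ su _ _ _; exact: (@smooth01_C1 _ _ 0 (su t t0)).
have [cut _ _] := cu.
pose c0 := hopf_coef e u 0%N t.
have c0_gt0 : 0 < c0 by apply: (hopf_coef0_gt0 eigen burgers); exact: ltW.
pose w x := c0^-1 * hopf_w (u t) x.
have w_C1 : C1_01 w (fun x => c0^-1 * (- 2^-1 * u t x * hopf_w (u t) x)).
  apply: C1_01Z; exact: C1_01_expR (C1_01Z (- 2^-1) (prim01_C1 cut)).
have [cw _ _] := w_C1.
have wE : {in `]0, 1[, w =1 F}.
  apply: (heat_sum_unique smoothV Vpos eigen C1_gt0 sobolev rhoB t0 cw) => n.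
  rewrite /w l2dotZr; [|exact: (eigen_L2 eigen)|exact/cont01_L2/hopf_w_cont].
  rewrite -/(hopf_coef e u n t) (hopf_coef_heat smoothV eigen u0_L2 burgers)//.
  by rewrite mulKf// gt_eqF.
have FC := heat_sum_C1 smoothV Vpos eigen C1_gt0 sobolev rhoB t0.
have := C1_01_eq_derive w_C1 FC wE x01o.
rewrite -/(G x) /F -/F => <-; rewrite -(wE x x01o) /w.
have wn0 : hopf_w (u t) x != 0 by rewrite gt_eqF// expR_gt0.
have cn0 : c0 != 0 by rewrite gt_eqF.
by field; rewrite cn0 wn0.
Qed.

(** Separates the factor of [q0] from a product over the entries of [q], the shape to which the
    tuple-sum lemma applies. *)
Lemma koopman_termE x q0 q : koopman_term mu e u0 t x q0 q =
  - 2 * (r q0 * D01 (e q0) x / e 0%N x) *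
    ((- 1) ^+ size q * \prod_(i <- q) a x i).
Proof.
rewrite /koopman_term /koopman_mode.
have -> : expR (- koopman_lambda mu (q0 :: q) * t) * koopman_phi e (q0 :: q) u0
  =
    \prod_(i <- q0 :: q) r i.
  rewrite /koopman_lambda /koopman_phi /r /heat_coef [RHS]big_split /=.
  congr (_ * _); rewrite -expR_sum; congr expR; rewrite -sumrN mulr_suml.
  by apply: eq_bigr.
rewrite big_cons.
rewrite [\prod_(i <- q) a x i](_ : _ =
    (\prod_(i <- q) r i) * \prod_(i <- q) (e i x / e 0%N x)).
  by rewrite exprS; ring.
by rewrite -big_split; apply: eq_bigr => i _; rewrite /a -mulrA.
Qed.

Lemma koopman_decomposition_core x : x \in `[0, 1] ->
  koopman_decomposition mu e u0 t x (u t x).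
Proof.
move=> x01; pose b q0 := - 2 * (r q0 * D01 (e q0) x / e 0%N x).
(* Summing over the tuples gives a power of [z], summing over [m] gives a geometric series of ratio
   [- z x], and the sum over [q0] that remains is the series of [G]. *)
exists (fun q0 m => b q0 * (- z x) ^+ m), (fun q0 => b q0 / (1 + z x)).
have e0 := eigen0_gt0 eigen x01.
split.
- move=> q0 m.
  have FF := @summability.totally_filter (m.-tuple {n : nat | n != 0%N}).
  have H := @unordered_tuple_sum R (a x) m (abs_cvg x01).
  have : (b q0 * (- 1) ^+ m) * summability.partial_sum
      (fun q : m.-tuple {n : nat | n != 0%N} => \prod_(i <- map val q) a x i) A
      @[A --> summability.totally] --> (b q0 * (- 1) ^+ m) * z x ^+ m.
    by apply: cvgM => //; exact: cvg_cst.
  rewrite -mulrA -exprMn mulN1r.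
  apply: cvg_trans; apply: near_eq_cvg; apply: nearW => A.
  rewrite /summability.partial_sum mulr_sumr; apply: eq_bigr => q _.
  by rewrite koopman_termE size_map size_tuple mulrA.
- move=> q0; have := @cvg_geometric_series R (b q0) (- z x).
  by rewrite normrN opprK => /(_ (z_lt1 x01)).
- have [B rhoB] := koopman_ratio_bounded eigen u0_L2.
  have cG := heat_sum1_cvg smoothV Vpos eigen C1_gt0 sobolev rhoB t0 x01.
  have -> : u t x = (- 2 / e 0%N x / (1 + z x)) * G x.
    rewrite burgers_quotient// F_z//; field.
    by rewrite (gt_eqF e0) (gt_eqF (one_z x01)).
  have : (- 2 / e 0%N x / (1 + z x)) * series (fun n => r n * D01 (e n) x) N
      @[N --> \oo] --> (- 2 / e 0%N x / (1 + z x)) * G x.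
    by apply: cvgM => //; exact: cvg_cst.
  apply: cvg_trans; apply: near_eq_cvg; apply: nearW => N.
  rewrite /series /= mulr_sumr; apply: eq_bigr => n _.
  by rewrite /b; ring.
Qed.

End Core.
End Decomposition.

(** * Stability of the Cole-Hopf transform near the stationary state *)

Lemma le_double_of_close {R : realFieldType} (a b eta : R) : 0 < a ->
  eta <= 2^-1 -> `|b - a| <= eta * a -> a <= 2 * b.
Proof.
by move=> a0 eta2; have := ler_wpM2r (ltW a0) eta2; rewrite ler_norml; lra.
Qed.

(** Numerator and denominator each contribute an error [eta * b], and replacing [J] by [I] costs a
    factor 2 since [I <= 2 * J]; hence the 4. *)
Lemma quotient_dist {R : realFieldType} (a b I J eta : R) :
  0 < I -> 0 < J -> 0 < b -> eta <= 2^-1 ->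
  `|a - b| <= eta * b -> `|J - I| <= eta * I ->
  `|J^-1 * a - I^-1 * b| <= 4 * eta * (I^-1 * b).
Proof.
move=> I0 J0 b0 eta2 ab JI; have J2 := le_double_of_close I0 eta2 JI.
have eta0 : 0 <= eta by rewrite -(pmulr_lge0 _ b0); exact: le_trans ab.
have -> : J^-1 * a - I^-1 * b = ((a - b) - I^-1 * b * (J - I)) / J.
  by field; rewrite !gt_eqF.
rewrite normrM normfV (gtr0_norm J0) ler_pdivrMr//.
apply: (le_trans (ler_normB _ _)).
apply: (@le_trans _ _ (2 * eta * b)).
  have -> : 2 * eta * b = eta * b + eta * b by ring.
  apply: lerD => //.
  rewrite normrM gtr0_norm ?mulr_gt0 ?invr_gt0//.
  apply: (@le_trans _ _ (I^-1 * b * (eta * I))).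
    by rewrite ler_pM2l// mulr_gt0 ?invr_gt0.
  by have -> : I^-1 * b * (eta * I) = eta * b by field; rewrite gt_eqF.
have -> : 4 * eta * (I^-1 * b) * J = 2 * eta * b * (2 * J / I) by field;
  rewrite gt_eqF.
apply: ler_peMr; first by rewrite !mulr_ge0// ltW.
by rewrite ler_pdivlMr// mul1r.
Qed.

Section Neighborhood.
Context {R : realType}.
Variables (V : R -> R) (mu : nat -> R) (e : nat -> R -> R).
Hypothesis eigen : neumann_eigensystem V mu e.

Let e0_gt0 (x : R) : x \in `[0, 1] -> 0 < e 0%N x :=
  @eigen0_gt0 _ _ _ _ eigen x.

Lemma s0_burgers_cont : cont01 (s0_burgers e).
Proof.
have [ce cde _] := eigen_C1 eigen 0%N.
apply/cont01P => x x01; apply: cvgM.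
  by apply: cvgM; [exact: cvg_cst|exact: (cont01P _).1 cde x x01].
by apply: cvgV; [rewrite gt_eqF ?e0_gt0|exact: (cont01P _).1 ce x x01].
Qed.

(* Multiplying e_0 by the integrating factor of s_0 gives a constant. *)
Lemma eigen0_hopf_w (x : R) : x \in `[0, 1] ->
  e 0%N x = e 0%N 0 * hopf_w (s0_burgers e) x.
Proof.
move=> x01; set s := s0_burgers e; have cs : cont01 s := s0_burgers_cont.
have := C1_01M (eigen_C1 eigen 0%N) (C1_01_expR (C1_01Z 2^-1 (prim01_C1 cs))).
set q := (X in C1_01 X _); set q1 := (X in C1_01 _ X) => Cq.
have q10 y : y \in `[0, 1] -> `|q1 y| <= 0.
  move=> y01; rewrite normr_le0; apply/eqP; rewrite /q1 /s /s0_burgers.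
  by field; rewrite gt_eqF ?e0_gt0.
have := C1_01_lipschitz Cq q10 zero_in01 x01.
rewrite mul0r normr_le0 subr_eq0 /q prim01_0 mulr0 expR0 mulr1 => /eqP <-.
by rewrite /hopf_w -mulrA -expRD mulNr subrr expR0 mulr1.
Qed.

Lemma cole_hopf_s0 (x : R) : x \in `[0, 1] ->
  cole_hopf (s0_burgers e) x = f0tilde e x.
Proof.
move=> x01; rewrite /f0tilde (eigen0_hopf_w x01).
have -> : \int[leb]_(y in `[0, 1]) e 0%N y =
    e 0%N 0 * \int[leb]_(y in `[0, 1]) hopf_w (s0_burgers e) y.
  rewrite -RintegralZl//; last first.
    exact/cont01_integrable/hopf_w_cont/cont01_L2/s0_burgers_cont.
  by apply: eq_Rintegral => y; rewrite inE; exact: eigen0_hopf_w.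
have e00 := gt_eqF (e0_gt0 zero_in01).
by rewrite invfM mulrACA divff ?e00// mul1r.
Qed.

Lemma cole_hopf_dist (u v : R -> R) (eta x : R) : L2_01 u -> L2_01 v ->
  expR (2^-1 * l2norm (u \- v)) - 1 <= eta -> eta <= 2^-1 -> x \in `[0, 1] ->
  `|cole_hopf u x - cole_hopf v x| <= 4 * eta * cole_hopf v x.
Proof.
move=> uL vL Eeta eta2 x01.
have cu := hopf_w_cont uL; have cv := hopf_w_cont vL.
have dist y : y \in `[0, 1] -> `|hopf_w u y - hopf_w v y| <= eta * hopf_w v y.
  move=> y01; apply: (le_trans (expR_prim_dist uL vL y01)).
  by rewrite mulrC ler_wpM2r ?expR_ge0.
pose I := \int[leb]_(y in `[0, 1]) hopf_w v y.
pose J := \int[leb]_(y in `[0, 1]) hopf_w u y.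
have I0 : 0 < I by exact: hopf_w_mass_gt0.
have J0 : 0 < J by exact: hopf_w_mass_gt0.
have iu := cont01_integrable cu; have iv := cont01_integrable cv.
have JI : `|J - I| <= eta * I.
  rewrite /J /I -RintegralB// -RintegralZl//.
  have cuv := cont01B cu cv.
  apply: (le_trans (le_normr_Rintegral _ _)) => //;
    first exact: cont01_integrable.
  apply: le_Rintegral => //.
  - by apply: cont01_integrable => y; apply: cvg_norm; exact: cuv.
  - by apply: cont01_integrable; apply: cont01M => //; exact: cont01_cst.
have w0 : 0 < hopf_w v x by exact: expR_gt0.
have := quotient_dist I0 J0 w0 eta2 (dist x x01) JI.
by rewrite /J /I !cole_hopfE.
Qed.

Lemma cole_hopf_neighborhood (delta : R) : 0 < delta ->
  L2_neighborhood (s0_burgers e)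
    [set u | L2_01 u /\ l2norm (cole_hopf u \- f0tilde e) < delta].
Proof.
move=> delta0; have sL : L2_01 (s0_burgers e) by
  exact/cont01_L2/s0_burgers_cont.
split=> //; have [K K0 HK] := cont01_bounded (f0tilde_cont eigen).
(* The bound 1/2 is what the quotient estimate asks for; the other one gives
   [4 * eta * K <= delta / 2], half of [delta] because the passage from sup to L^2 norm is not
   strict. *)
pose eta := Num.min 2^-1 (delta / (8 * K)).
have eta0 : 0 < eta by rewrite lt_min invr_gt0 ltr0n divr_gt0 ?mulr_gt0.
have eta1 : 1 < 1 + eta by rewrite ltrDl.
(* The radius [r] that solves [expR (r / 2) - 1 = eta]. *)
exists (2 * ln (1 + eta)); first by rewrite mulr_gt0// ln_gt0.
move=> u uL ur; split => //.
have E : expR (2^-1 * l2norm (u \- s0_burgers e)) - 1 <= eta.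
  rewrite lerBlDl -[leRHS]lnK ?posrE ?(lt_trans ltr01)// ler_expR.
  by rewrite -ler_pdivlMl ?invr_gt0// invrK ltW.
have cf : cont01 (fun x => cole_hopf u x - f0tilde e x).
  by apply: cont01B; [exact: cole_hopf_cont|exact: (f0tilde_cont eigen)].
apply: (@le_lt_trans _ _ (delta / 2)); last first.
  by rewrite ltr_pdivrMr// ltr_pMr// ltr1n.
apply: l2norm_le_sup => //; first by rewrite divr_ge0// ltW.
move=> x x01 /=; rewrite -(cole_hopf_s0 x01).
have eta2 : eta <= 2^-1 by rewrite ge_min lexx.
apply: (le_trans (cole_hopf_dist uL sL E eta2 x01)).
rewrite (cole_hopf_s0 x01); apply: (@le_trans _ _ (4 * eta * K)).
  rewrite ler_pM2l ?mulr_gt0//; apply: le_trans (HK x x01); exact: ler_norm.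
have : eta <= delta / (8 * K) by rewrite ge_min lexx orbT.
rewrite ler_pdivlMr ?mulr_gt0// => H.
rewrite ler_pdivlMr//; apply: le_trans H.
by rewrite le_eqVlt; apply/orP; left; apply/eqP; ring.
Qed.

End Neighborhood.

Theorem mainTheorem2 (R : realType) (V : R -> R) (mu : nat -> R)
    (e : nat -> R -> R) (C1 : R) :
  smooth01 V ->
  (forall x : R, x \in `[0, 1] -> 0 < V x) ->
  neumann_eigensystem V mu e ->
  0 < C1 -> sobolev_constant C1 ->
  (forall (u0 : R -> R) (u : R -> R -> R),
     L2_01 u0 -> burgers_solution V u0 u ->
     forall t x : R, tau_burgers mu e C1 u0 < t -> x \in `[0, 1] ->
       koopman_decomposition mu e u0 t x (u t x)) /\
  (forall theta0 : R, 0 < theta0 ->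
     L2_neighborhood (s0_burgers e) (Omega_burgers mu e C1 theta0) /\
     forall (u0 : R -> R) (u : R -> R -> R),
       Omega_burgers mu e C1 theta0 u0 -> burgers_solution V u0 u ->
       forall t x : R, theta0 < t -> x \in `[0, 1] ->
         koopman_decomposition mu e u0 t x (u t x)).

Proof.
move=> smoothV Vpos eigen C1_gt0 sobolev.
have core := koopman_decomposition_core smoothV Vpos eigen C1_gt0 sobolev.
have m0_gt0 := m0_gt0 eigen.
have h1p := h1_gt0 smoothV Vpos eigen C1_gt0 sobolev.
have h1d := h1_decr smoothV Vpos eigen C1_gt0 sobolev.
split.
  move=> u0 u u0L burgers t x tau_lt x01.
  move: tau_lt; rewrite /tau_burgers; set d := l2norm _.
  (* At distance 0 the threshold is 0 by convention, and the smallness condition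
     [h1 t * 0 < m0 ^+ 2] holds at every positive time. *)
  have [d0|dn0] := eqVneq d 0.
    move=> t0; apply: core => //.
    by rewrite -/d d0 mulr0 exprn_gt0.
  have d_gt0 : 0 < d by rewrite lt_def dn0 l2norm_ge0.
  have y0 : 0 < m0 e ^+ 2 / d by rewrite divr_gt0// exprn_gt0.
  have [s0 hs] := h1_inv_spec smoothV Vpos eigen C1_gt0 sobolev y0.
  (* At the threshold [h1] equals [m0 ^+ 2 / d]; its strict decrease gives the strict inequality at
     every later [t]. *)
  move=> st; apply: core => //; first exact: lt_trans st.
  by rewrite -/d -ltr_pdivlMr// -hs; exact: h1d.
move=> theta0 theta0_gt0; have h0 := h1p _ theta0_gt0.
split.
  by apply: (cole_hopf_neighborhood eigen); rewrite divr_gt0// exprn_gt0.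
move=> u0 u [u0L dlt] burgers t x tt x01; apply: core => //.
  exact: lt_trans tt.
move: dlt; rewrite ltr_pdivlMr// mulrC; apply: le_lt_trans.
by rewrite ler_wpM2r ?l2norm_ge0// ltW// h1d.
Qed.
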